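(* Model-checking $ATL$ and $ATL^*$ with finite-memory semantics in incomplete information games is undecidable for $n\ge 3$ players. That is, for every $n\ge3$ there is no algorithm that, given an $n$-player iCGM $\mathcal M$, a state $s$ of $\mathcal M$ and an $ATL$ formula (respectively an $ATL^*$ state formula) $\varphi$, decides whether $\mathcal M,s\models_{iF}\varphi$. This holds even when the input formulas are restricted to the form $\langle\!\langle A\rangle\!\rangle\mathbf G\neg p$ with $A$ a set of players and $p$ a proposition.
   Context: A concurrent game structure with incomplete information (iCGS) with $n$ players is $\mathcal G=(\mathrm{States},\mathrm{Agt},\mathrm{Act},\mathrm{Mov},\mathrm{Tab},(\sim_j)_{1\le j\le n})$ with $\mathrm{States}$ a finite non-empty set, $\mathrm{Agt}=\{1,\dots,n\}$, $\mathrm{Act}$ a finite non-empty set, $\mathrm{Mov}:\mathrm{States}\times\mathrm{Agt}\to 2^{\mathrm{Act}}\setminus\{\emptyset\}$ the legal actions, $\mathrm{Tab}(s,(a_1,\dots,a_n))\in\mathrm{States}$ defined for every state $s$ and all $(a_1,\dots,a_n)$ with $a_j\in\mathrm{Mov}(s,j)$ (such tuples are called moves), and each $\sim_j$ an equivalence relation on $\mathrm{States}$ such that $s\sim_j s'$ implies $\mathrm{Mov}(s,j)=\mathrm{Mov}(s',j)$. $[s]_j$ is the $\sim_j$-class (observation set) of $s$. An iCGM is $\mathcal M=(\mathcal G,\pi)$ with $\pi:\mathrm{States}\to 2^{\mathrm{Prop}}$, where $\mathrm{Prop}$ is a finite set of propositions. An outcome is an infinite sequence of states in which each consecutive pair is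 connected by some move; a history is a non-empty finite prefix of an outcome; the history $s_0\cdots s_l$ induces for player $j$ the observation history $[s_0]_j\cdots[s_l]_j$. A finite-memory strategy for player $j$ is a map from observation histories of $j$ to actions legal for $j$ in the last observation set, for which there is a deterministic finite-state transducer with a finite non-empty set $M$ of memory states, initial state $m_0\in M$, input alphabet the observation sets of $j$, transition function $T$ and output function $G$ (with $T(m,o)\in M$ and $G(m,o)\in\mathrm{Act}$) such that on each observation history $o_0\cdots o_l$ the strategy plays $G(m_l,o_l)$, where $m_{i+1}=T(m_i,o_i)$. $\mathrm{Out}_{\mathcal G}(s,\sigma_A)$ is the set of outcomes from $s$ that are possible when each $a\in A$ follows $\sigma_a$ (the remaining players choosing arbitrary legal actions). $ATL^*$ formulas: $\varphi::=p\mid\neg\varphi\mid\varphi\vee\varphi\mid\mathbf X\varphi\mid\varphi\mathbf U\varphi\mid\langle\!\langle A\rangle\!\rangle\varphi$ with $p\in\mathrm{Prop}$, $A\subseteq\mathrm{Agt}$; $\mathbf F,\mathbf G$ are defined as usual. State formulas are propositions, Boolean combinations of state formulas, and $\langle\!\langle A\rangle\!\rangle\varphi$ for any $ATL^*$ formula $\varphi$. $ATL$ formulas: $\varphi::=p\mid\neg\varphi\mid\varphi\vee\varphi\mid\langle\!\langle A\rangle\!\rangle\mathbf X\varphi\mid\langle\!\langle A\rangle\!\rangle\mathbf G\varphi\mid\langle\!\langle A\rangle\!\rangle(\varphi\mathbf U\varphi)$. Propositions, Boolean connectives, $\mathbf X$, $\mathbf U$ are interpreted as usual; a state formula holds on a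 path iff it holds at its first state. $\mathcal M,s\models_{iF}\langle\!\langle A\rangle\!\rangle\varphi$ iff there are finite-memory strategies $\sigma_A=(\sigma_a)_{a\in A}$ such that for every $a\in A$, every $s'\sim_a s$ and every $\rho\in\mathrm{Out}_{\mathcal G}(s',\sigma_A)$, $\mathcal M,\rho\models_{iF}\varphi$. *)

(* Defs.v *)
From mathcomp Require Import all_boot.

Set Implicit Arguments.
Unset Strict Implicit.
Unset Printing Implicit Defensive.

(* Algorithms are partial mu-recursive functions on nat.
   Arities are not tracked: [Succ] and [Proj] read missing arguments as 0, and
   superfluous arguments
   are ignored, which yields the usual class of partial recursive functions.
   [PrimRec f g] recurses on, and [Mu f] searches over, the first argument. *)
Inductive murec : Type :=
| Zero
| Succ
| Proj of nat
| Comp of murec & seq murec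
| PrimRec of murec & murec
| Mu of murec.

Inductive eval : murec -> seq nat -> nat -> Prop :=
| eval_Zero xs : eval Zero xs 0
| eval_Succ xs : eval Succ xs (nth 0 xs 0).+1
| eval_Proj i xs : eval (Proj i) xs (nth 0 xs i)
| eval_Comp f gs xs ys y :
    eval_seq gs xs ys -> eval f ys y -> eval (Comp f gs) xs y
| eval_PrimRec0 f g xs y :
    eval f xs y -> eval (PrimRec f g) (0 :: xs) y
| eval_PrimRecS f g k xs r y :
    eval (PrimRec f g) (k :: xs) r -> eval g (k :: r :: xs) y ->
    eval (PrimRec f g) (k.+1 :: xs) y
| eval_Mu f xs k (v : nat -> nat) :
    (forall i, i < k -> eval f (i :: xs) (v i).+1) -> eval f (k :: xs) 0 ->
    eval (Mu f) xs k
with eval_seq : seq murec -> seq nat -> seq nat -> Prop :=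
| eval_nil xs : eval_seq [::] xs [::]
| eval_cons g gs xs y ys :
    eval g xs y -> eval_seq gs xs ys -> eval_seq (g :: gs) xs (y :: ys).

Definition is_move (n : nat) (Act : finType) (mov : 'I_n -> {set Act})
  (a : n.-tuple Act) : bool := [forall j, tnth a j \in mov j].

(* Player j of {1,...,n} is the element j-1 of 'I_n. *)
Record iCGS (n : nat) := ICGS {
  State : finType;
  State_gt0 : 0 < #|State|;
  Act : finType;
  Act_gt0 : 0 < #|Act|;
  Mov : State -> 'I_n -> {set Act};
  Mov_neq0 : forall s j, Mov s j != set0;
  Tab : forall s, {a : n.-tuple Act | is_move (Mov s) a} -> State;
  indis : 'I_n -> rel State;
  indis_equiv : forall j, equivalence_rel (indis j);
  indis_Mov : forall j s t, indis j s t -> Mov s j = Mov t j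
}.

Record iCGM (n : nat) (AP : finType) := ICGM {
  game :> iCGS n;
  label : State game -> {set AP}
}.

Definition move (n : nat) (G : iCGS n) (s : State G) : finType :=
  {a : n.-tuple (Act G) | is_move (@Mov n G s) a}.

Definition obs_class (n : nat) (G : iCGS n) (j : 'I_n) (s : State G) :
  {set State G} := [set t | indis j s t].

Definition obs (n : nat) (G : iCGS n) (j : 'I_n) : finType :=
  {o : {set State G} | [exists s, o == obs_class j s]}.

Lemma obs_classP (n : nat) (G : iCGS n) (j : 'I_n) (s : State G) :
  [exists t, obs_class j s == obs_class j t].
Proof. by apply/existsP; exists s. Qed.

Definition obs_of (n : nat) (G : iCGS n) (j : 'I_n) (s : State G) : obs G j :=
  exist _ (obs_class j s) (obs_classP j s).

Definition outcome (n : nat) (G : iCGS n) (rho : nat -> State G) : Prop :=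
  forall i, exists m : move (rho i), Tab m = rho i.+1.

(* The observation history of j induced by the history rho 0, ..., rho l. *)
Definition obs_history (n : nat) (G : iCGS n) (j : 'I_n)
  (rho : nat -> State G) (l : nat) : seq (obs G j) :=
  [seq obs_of j s | s <- mkseq rho l.+1].

Record transducer (I O : Type) := Transducer {
  memory : finType;
  mem0 : memory;
  trans : memory -> I -> memory;
  out : memory -> I -> O
}.

(* A strategy is represented by a function on all sequences of observation
   sets; only its values on observation histories matter. *)
Definition strategy (n : nat) (G : iCGS n) (j : 'I_n) : Type :=
  seq (obs G j) -> Act G.

Definition legal_strategy (n : nat) (G : iCGS n) (j : 'I_n)
  (sigma : strategy G j) : Prop :=
  forall (rho : nat -> State G) (l : nat), outcome rho ->
    sigma (obs_history j rho l) \in Mov (rho l) j.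

(* The memory state m_l is reached after reading o_0, ..., o_(l-1) only. *)
Definition realizes (n : nat) (G : iCGS n) (j : 'I_n)
  (T : transducer (obs G j) (Act G)) (sigma : strategy G j) : Prop :=
  forall (rho : nat -> State G) (l : nat), outcome rho ->
    sigma (obs_history j rho l) =
    out (foldl (@trans _ _ T) (mem0 T) [seq obs_of j s | s <- mkseq rho l])
        (obs_of j (rho l)).

Definition finite_memory_strategy (n : nat) (G : iCGS n) (j : 'I_n)
  (sigma : strategy G j) : Prop :=
  legal_strategy sigma /\
  exists T : transducer (obs G j) (Act G), realizes T sigma.

Definition Out (n : nat) (G : iCGS n) (s : State G) (A : {set 'I_n})
  (sigma : forall j, strategy G j) (rho : nat -> State G) : Prop :=
  rho 0 = s /\
  forall i, exists m : move (rho i), Tab m = rho i.+1 /\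
    forall j, j \in A -> tnth (val m) j = sigma j (obs_history j rho i).

Inductive form (n : nat) (AP : finType) : Type :=
| Atom of AP
| Neg of form n AP
| Or of form n AP & form n AP
| Next of form n AP
| Until of form n AP & form n AP
| Coop of {set 'I_n} & form n AP.

(* The grammar has no constant "true"; f \/ ~ f plays its role. *)
Definition Eventually (n : nat) (AP : finType) (f : form n AP) : form n AP :=
  Until (Or f (Neg f)) f.

Definition Always (n : nat) (AP : finType) (f : form n AP) : form n AP :=
  Neg (Eventually (Neg f)).

Inductive is_state_form (n : nat) (AP : finType) : form n AP -> Prop :=
| state_Atom p : is_state_form (Atom n p)
| state_Neg f : is_state_form f -> is_state_form (Neg f)
| state_Or f g : is_state_form f -> is_state_form g -> is_state_form (Or f g)
| state_Coop A f : is_state_form (Coop A f).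

Inductive is_ATL (n : nat) (AP : finType) : form n AP -> Prop :=
| ATL_Atom p : is_ATL (Atom n p)
| ATL_Neg f : is_ATL f -> is_ATL (Neg f)
| ATL_Or f g : is_ATL f -> is_ATL g -> is_ATL (Or f g)
| ATL_Next A f : is_ATL f -> is_ATL (Coop A (Next f))
| ATL_Always A f : is_ATL f -> is_ATL (Coop A (Always f))
| ATL_Until A f g : is_ATL f -> is_ATL g -> is_ATL (Coop A (Until f g)).

Definition is_safety (n : nat) (AP : finType) (f : form n AP) : Prop :=
  exists (A : {set 'I_n}) (p : AP), f = Coop A (Always (Neg (Atom n p))).

(* For A = set0 the condition on outcomes is vacuous. *)
Definition can_enforce (n : nat) (G : iCGS n) (A : {set 'I_n})
  (P : (nat -> State G) -> Prop) (s : State G) : Prop :=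
  exists sigma : forall j, strategy G j,
    (forall j, j \in A -> finite_memory_strategy (sigma j)) /\
    forall j, j \in A -> forall s', indis j s s' ->
    forall rho, Out s' A sigma rho -> P rho.

Fixpoint sat_path (n : nat) (AP : finType) (M : iCGM n AP) (f : form n AP)
  (rho : nat -> State M) : Prop :=
  match f with
  | Atom p => p \in label (rho 0)
  | Neg g => ~ sat_path g rho
  | Or g h => sat_path g rho \/ sat_path h rho
  | Next g => sat_path g (fun i => rho i.+1)
  | Until g h => exists k, sat_path h (fun i => rho (k + i)) /\
                   forall l, l < k -> sat_path g (fun i => rho (l + i))
  | Coop A g => can_enforce A (@sat_path n AP M g) (rho 0)
  end.

(* Meaningful for state formulas only. *)
Fixpoint sat_state (n : nat) (AP : finType) (M : iCGM n AP) (f : form n AP)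
  (s : State M) : Prop :=
  match f with
  | Atom p => p \in label s
  | Neg g => ~ sat_state g s
  | Or g h => sat_state g s \/ sat_state h s
  | Next _ | Until _ _ => False
  | Coop A g => can_enforce A (@sat_path n AP M g) s
  end.

Lemma sat_path_state (n : nat) (AP : finType) (M : iCGM n AP) (f : form n AP)
  (rho : nat -> State M) :
  is_state_form f -> (sat_path f rho <-> sat_state f (rho 0)).
Proof. by elim=> //= [g _|g h _ ? _ ?]; tauto. Qed.

Lemma is_ATL_state (n : nat) (AP : finType) (f : form n AP) :
  is_ATL f -> is_state_form f.
Proof. by elim=> *; constructor. Qed.

(* [CodeSeq.code] is a bijection from seq nat to nat. *)
Definition code_fun (T : finType) (f : T -> nat) : nat :=
  CodeSeq.code [seq f x | x : T].

(* States and actions are numbered by their rank in the enumeration of their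
   type, action tuples are listed lexicographically; 0 marks the tuples on
   which Tab is undefined.  The code determines the iCGM up to a renaming of
   its states and actions. *)
Definition code_iCGM (n : nat) (AP : finType) (M : iCGM n AP) : nat :=
  CodeSeq.code [::
    code_fun (fun s : State M => code_fun (fun j : 'I_n =>
      code_fun (fun c : Act M => nat_of_bool (c \in Mov s j))));
    code_fun (fun s : State M => code_fun (fun a : n.-tuple (Act M) =>
      if (insub a : option (move s)) is Some m
      then (enum_rank (Tab m)).+1 else 0));
    code_fun (fun j : 'I_n => code_fun (fun s : State M =>
      code_fun (fun t : State M => nat_of_bool (indis j s t))));
    code_fun (fun s : State M =>
      code_fun (fun p : AP => nat_of_bool (p \in label s)))].

Fixpoint code_form (n : nat) (AP : finType) (f : form n AP) : nat :=
  match f with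
  | Atom p => CodeSeq.code [:: 0; nat_of_ord (enum_rank p)]
  | Neg g => CodeSeq.code [:: 1; code_form g]
  | Or g h => CodeSeq.code [:: 2; code_form g; code_form h]
  | Next g => CodeSeq.code [:: 3; code_form g]
  | Until g h => CodeSeq.code [:: 4; code_form g; code_form h]
  | Coop A g => CodeSeq.code
      [:: 5; code_fun (fun j : 'I_n => nat_of_bool (j \in A)); code_form g]
  end.

Definition code_input (n : nat) (AP : finType) (M : iCGM n AP) (s : State M)
  (f : form n AP) : nat :=
  CodeSeq.code [:: code_iCGM M; nat_of_ord (enum_rank s); code_form f].

(* Nothing is required of the algorithm on numbers that are not codes of
   inputs whose formula belongs to C. *)
Definition decidable_model_checking (n : nat) (AP : finType)
  (C : form n AP -> Prop) : Prop :=
  exists e : murec, forall (M : iCGM n AP) (s : State M) (f : form n AP),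
    C f ->
    (sat_state f s -> eval e [:: code_input s f] 1) /\
    (~ sat_state f s -> eval e [:: code_input s f] 0).

(* Main.v *)
Require Import Defs.
From mathcomp Require Import all_boot zify.

Set Implicit Arguments.
Unset Strict Implicit.
Unset Printing Implicit Defensive.

(* Reduction from the halting problem of counter machines.  The two team players
   describe a halting run backwards in time: asked the word "a^i b^k", player 1
   must name the tile at position (i, k), that is the control label of the
   configuration k steps before halting (or None, before the run starts) and, for
   each register r, whether i < r; player 2 must name the tile at (i + 1, k).
   Player 3 chooses the words.  Asking both players the same word checks the step
   relation on the 2 x 2 block of tiles at (i, k); asking player 1 for the word of
   player 2 with one more a checks that they describe the same picture.  A halting
   run yields finite-memory strategies that count up to a bound.  Conversely,
   finite memory makes two rows k < k' equal; if no row were labelled None,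
   determinism would carry this equality down to row 0 and a later row, although
   row 0 is halting and no later row is.  The input x of the machine
   enters the game as a corridor of x + 1 states along which both players are
   asked a^(x+1), so that the game code depends on x in a simple way and a decider
   can be diagonalised against: x is taken to code the rest of the game. *)

(** * Counter machines and the compilation of recursive functions *)

Section Counter.
Variable R : finType.

Inductive instr (X : Type) : Type :=
| Inc of R & X
| Dec of R & X
| Test of R & X & X
| Halt.

Definition store := R -> nat.

Definition upd (A : eqType) (c : A -> nat) (r : A) (v : nat) : A -> nat :=
  fun r' => if r' == r then v else c r'.

Definition step (X : Type) (prog : X -> instr X) (q : X * store) : X * store :=
  match prog q.1 with
  | Inc r l => (l, upd q.2 r (q.2 r).+1)
  | Dec r l => (l, upd q.2 r (q.2 r).-1)
  | Test r l0 l1 => (if q.2 r == 0 then l0 else l1, q.2)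
  | Halt => q
  end.

Definition halts (X : Type) (prog : X -> instr X) (q : X * store) : Prop :=
  exists k, prog (iter k (step prog) q).1 = Halt X.

Lemma step_halted (X : Type) (prog : X -> instr X) q k :
  prog q.1 = Halt X -> iter k (step prog) q = q.
Proof. by move=> h; elim: k => //= k ->; rewrite /step h. Qed.

Lemma halts_iter (X : Type) (prog : X -> instr X) q k :
  halts prog (iter k (step prog) q) <-> halts prog q.
Proof.
split=> [[m hm]|[m hm]]; first by exists (m + k); rewrite iterD.
exists m; rewrite -iterD addnC iterD step_halted //.
Qed.

End Counter.

(** * While programs over registers and their translation into counter machines *)

Inductive cmd (A : Type) : Type :=
| CInc of A
| CDec of A
| CSeq of cmd A & cmd A
| CWhile of A & cmd A.

Inductive exec (A : eqType) : cmd A -> (A -> nat) -> (A -> nat) -> Prop :=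
| exec_Inc r c d : d =1 upd c r (c r).+1 -> exec (CInc r) c d
| exec_Dec r c d : d =1 upd c r (c r).-1 -> exec (CDec r) c d
| exec_Seq a b c d e : exec a c d -> exec b d e -> exec (CSeq a b) c e
| exec_While0 r a c d : d =1 c -> c r = 0 -> exec (CWhile r a) c d
| exec_WhileS r a c d e : c r != 0 -> exec a c d -> exec (CWhile r a) d e ->
    exec (CWhile r a) c e.

Section Labels.
Variable R : finType.

Fixpoint lab (c : cmd R) : finType :=
  match c with
  | CInc _ | CDec _ => unit
  | CSeq a b => (lab a + lab b)%type
  | CWhile _ a => option (lab a)
  end.

Fixpoint entry (c : cmd R) : lab c :=
  match c with
  | CInc _ | CDec _ => tt
  | CSeq a b => inl (entry a)
  | CWhile _ a => None
  end.

(** [emb] places the local labels among those of the whole machine, and the argument of type [X] is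
    the label reached on exit. *)
Fixpoint code (c : cmd R) (X : Type) : (lab c -> X) -> X -> lab c -> instr R X :=
  match c with
  | CInc r => fun _ x _ => Inc r x
  | CDec r => fun _ x _ => Dec r x
  | CSeq a b => fun emb x l =>
      match l with
      | inl l => code (fun l => emb (inl l)) (emb (inr (entry b))) l
      | inr l => code (fun l => emb (inr l)) x l
      end
  | CWhile r a => fun emb x l =>
      match l with
      | None => Test r x (emb (Some (entry a)))
      | Some l => code (fun l => emb (Some l)) (emb None) l
      end
  end.

(* Stores are compared pointwise, which avoids functional extensionality. *)
Lemma exec_code c s s' : exec c s s' ->
  forall (X : Type) (prog : X -> instr R X) (emb : lab c -> X) (x : X),
  (forall l, prog (emb l) = code emb x l) ->
  forall t, t =1 s -> exists k t', t' =1 s' /\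
    iter k (step prog) (emb (entry c), t) = (x, t').
Proof.
elim=> {c s s'}.
- move=> r c d hd X prog emb x hp t ht; exists 1; eexists; split; last first.
    by rewrite /= /step /= hp /=.
  by move=> r'; rewrite hd /upd !ht.
- move=> r c d hd X prog emb x hp t ht; exists 1; eexists; split; last first.
    by rewrite /= /step /= hp /=.
  by move=> r'; rewrite hd /upd !ht.
- move=> a b c d e _ IHa _ IHb X prog emb x hp t ht.
  have [k [t' [ht' e1]]] := IHa X prog (fun l => emb (inl l))
     (emb (inr (entry b))) (fun l => hp (inl l)) t ht.
  have [m [t'' [ht'' e2]]] := IHb X prog (fun l => emb (inr l)) x
     (fun l => hp (inr l)) t' ht'.
  by exists (m + k), t''; split=> //; rewrite iterD e1.
- move=> r a c d hd c0 X prog emb x hp t ht; exists 1, t; split.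
    by move=> r'; rewrite hd ht.
  by rewrite /= /step /= hp /= ht c0.
- move=> r a c d e cr _ IHa _ IHw X prog emb x hp t ht.
  have [k [t' [ht' e1]]] := IHa X prog (fun l => emb (Some l)) (emb None)
     (fun l => hp (Some l)) t ht.
  have [m [t'' [ht'' e2]]] := IHw X prog emb x hp t' ht'.
  exists (m + (k + 1)), t''; split=> //.
  rewrite iterD iterD.
  have -> : iter 1 (step prog) (emb (entry (CWhile r a)), t) =
            (emb (Some (entry a)), t).
    by rewrite /= /step /= hp /= ht (negbTE cr).
  by rewrite e1.
Qed.

End Labels.

Fixpoint cmap (A B : Type) (f : A -> B) (c : cmd A) : cmd B :=
  match c with
  | CInc r => CInc (f r)
  | CDec r => CDec (f r)
  | CSeq a b => CSeq (cmap f a) (cmap f b)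
  | CWhile r a => CWhile (f r) (cmap f a)
  end.

Fixpoint bound (c : cmd nat) : nat :=
  match c with
  | CInc r => r
  | CDec r => r
  | CSeq a b => maxn (bound a) (bound b)
  | CWhile r a => maxn r (bound a)
  end.

(** A program names finitely many registers, and [inord] is injective on numbers up to [N], so the
    register set can be made finite. *)
Lemma exec_cmap (N : nat) c s s' : exec c s s' -> bound c <= N ->
  exec (cmap (@inord N) c) (fun r => s (val r)) (fun r => s' (val r)).
Proof.
elim=> {c s s'} /=.
- move=> r c d hd hr; apply: exec_Inc => i.
  by rewrite hd /upd inordK // -val_eqE /= inordK.
- move=> r c d hd hr; apply: exec_Dec => i.
  by rewrite hd /upd inordK // -val_eqE /= inordK.
- by move=> a b c d e _ IHa _ IHb; rewrite geq_max => /andP[/IHa ha /IHb]; apply: exec_Seq.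
- move=> r a c d hd c0; rewrite geq_max => /andP[hr _].
  by apply: exec_While0 => [i|]; rewrite ?hd // inordK.
- move=> r a c d e c0 _ IHa _ IHw h; have := h; rewrite geq_max => /andP[hr ha].
  apply: exec_WhileS (IHa ha) (IHw h); by rewrite inordK.
Qed.

(** * Compilation of recursive functions to while programs *)

Definition clear (r : nat) : cmd nat := CWhile r (CDec r).

Lemma exec_clear r c d : d =1 upd c r 0 -> exec (clear r) c d.
Proof.
move En : (c r) => m; elim: m c En => [|m IH] c En hd.
  apply: exec_While0 => // r'; rewrite hd /upd; by case: eqP => [->|].
apply: (@exec_WhileS _ _ _ c (upd c r m)); first by rewrite En.
  by apply: exec_Dec; rewrite En.
apply: IH; first by rewrite /upd eqxx.
by move=> r'; rewrite hd /upd; case: eqP.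
Qed.

(** Reading a register empties it: [a] is poured into both [o] and [t], then refilled from [t]. *)
Definition copy (a o t : nat) : cmd nat :=
  CSeq (clear o) (CSeq (clear t)
    (CSeq (CWhile a (CSeq (CDec a) (CSeq (CInc o) (CInc t))))
          (CWhile t (CSeq (CDec t) (CInc a))))).

Lemma exec_copy a o t c : a != o -> a != t -> o != t ->
  exec (copy a o t) c (upd (upd c o (c a)) t 0).
Proof.
move=> ao at_ ot.
have oa : (o == a) = false by rewrite eq_sym (negbTE ao).
have ta : (t == a) = false by rewrite eq_sym (negbTE at_).
have to_ : (t == o) = false by rewrite eq_sym (negbTE ot).
apply: exec_Seq; first exact: exec_clear (frefl _).
apply: exec_Seq; first exact: exec_clear (frefl _).
pose st x y z : nat -> nat := upd (upd (upd c a x) o y) t z.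
have updE x y z : (st x y z a = x) * (st x y z o = y) * (st x y z t = z).
  by rewrite /st /upd !eqxx (negbTE ao) (negbTE at_) (negbTE ot).
have w1 x y z s : s =1 st x y z ->
   exec (CWhile a (CSeq (CDec a) (CSeq (CInc o) (CInc t)))) s
        (st 0 (x + y) (x + z)).
  elim: x y z s => [|x IH] y z s hs.
    by apply: exec_While0 => [r|]; rewrite ?hs ?updE.
  apply: (exec_WhileS (d := st x y.+1 z.+1)); first by rewrite hs updE.
    apply: (exec_Seq (d := st x y z)).
      apply: exec_Dec => r; rewrite /upd !hs !updE /st /upd.
      by case: (eqVneq r a) => [->|//]; rewrite (negbTE ao) (negbTE at_).
    apply: (exec_Seq (d := st x y.+1 z)).
      apply: exec_Inc => r; rewrite /upd updE /st /upd.
      by case: (eqVneq r o) => [->|//]; rewrite (negbTE ot).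
    apply: exec_Inc => r; rewrite /upd updE /st /upd.
    by case: (eqVneq r t).
  by have := IH y.+1 z.+1 _ (frefl _); rewrite !addnS !addSn.
have w2 x y z s e : s =1 st x y z -> e =1 st (z + x) y 0 ->
   exec (CWhile t (CSeq (CDec t) (CInc a))) s e.
  elim: z x s => [|z IH] x s hs he.
    by apply: exec_While0 => [r|]; rewrite ?hs ?updE ?he.
  apply: (exec_WhileS (d := st x.+1 y z)); first by rewrite hs updE.
    apply: (exec_Seq (d := st x y z)).
      apply: exec_Dec => r; rewrite /upd !hs !updE /st /upd.
      by case: (eqVneq r t).
    apply: exec_Inc => r; rewrite /upd updE /st /upd.
    by case: (eqVneq r a) => [->|//]; rewrite (negbTE ao) (negbTE at_).
  apply: IH => // r; by rewrite he addnS addSn.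
apply: (exec_Seq (d := st 0 (c a + 0) (c a + 0))).
  apply: w1 => r; rewrite /st /upd.
  case: (eqVneq r t) => // _; case: (eqVneq r o) => // _.
  by case: (eqVneq r a) => [->|].
apply: (w2 _ _ _ _ _ (frefl _)) => r; rewrite /st /upd.
case: (eqVneq r t) => // _; case: (eqVneq r o) => [_|_]; first by rewrite addn0.
case: (eqVneq r a) => [->|//]; by rewrite !addn0.
Qed.

(** Clearing [o] implements the default value 0 of a missing argument. *)
Definition fetch (args : seq nat) (i o t : nat) : cmd nat :=
  if i < size args then copy (nth 0 args i) o t else clear o.

Lemma exec_fetch args i o t b c :
  all (fun r => r < b) args -> o \notin args -> o < b -> b <= t ->
  exists d, exec (fetch args i o t) c d /\ d o = nth 0 (map c args) i /\
    forall r, r < b -> r != o -> d r = c r.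
Proof.
move=> /allP hb ho ob bt; rewrite /fetch; case: ltnP => hi.
  have hm := mem_nth 0 hi; have hl := hb _ hm.
  eexists; split; first apply: exec_copy.
  - by apply: contraNneq ho => <-.
  - by rewrite neq_ltn (leq_trans hl).
  - by rewrite neq_ltn (leq_trans ob).
  rewrite /upd eqxx (nth_map 0) //; split.
    by rewrite ifN // neq_ltn (leq_trans ob).
  move=> r rb ro; rewrite (negbTE ro) ifN // neq_ltn (leq_trans rb) //.
eexists; split; first exact: exec_clear (frefl _).
rewrite /upd eqxx nth_default ?size_map //; split=> // r _ /negbTE -> //.
Qed.

(** [args] are the argument registers, [o] is the output and [b] the first scratch register. For
    [PrimRec], [b] counts the remaining rounds, [b + 1] holds the current value and [b + 2] the
    recursion index; for [Mu], [b] is the candidate and [b + 1] the value of [f] there. *)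
Fixpoint compile (f : murec) (args : seq nat) (o b : nat) : cmd nat :=
  match f with
  | Zero => clear o
  | Succ => CSeq (fetch args 0 o b) (CInc o)
  | Proj i => fetch args i o b
  | Comp f gs =>
      CSeq ((fix compiles gs k :=
               match gs with
               | [::] => clear o
               | g :: gs => CSeq (compile g args (b + k) (b + k).+1) (compiles gs k.+1)
               end) gs 0)
           (compile f (iota b (size gs)) o (b + size gs))
  | PrimRec f g =>
      CSeq (fetch args 0 b (b + 4))
      (CSeq (compile f (behead args) (b + 1) (b + 4))
      (CSeq (clear (b + 2))
      (CSeq (CWhile b
        (CSeq (CDec b)
        (CSeq (compile g [:: b + 2, b + 1 & behead args] (b + 3) (b + 4))
        (CSeq (copy (b + 3) (b + 1) (b + 4)) (CInc (b + 2))))))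
       (copy (b + 1) o (b + 2)))))
  | Mu f =>
      CSeq (clear b)
      (CSeq (compile f (b :: args) (b + 1) (b + 2))
      (CSeq (CWhile (b + 1)
         (CSeq (CInc b) (compile f (b :: args) (b + 1) (b + 2))))
       (copy b o (b + 1))))
  end.

(* Nothing is assumed of the registers from [b] on: they are scratch space. *)
Definition compiled (f : murec) : Prop :=
  forall xs y, eval f xs y ->
  forall args o b c, map c args = xs -> all (fun r => r < b) args ->
    o \notin args -> o < b ->
  exists d, exec (compile f args o b) c d /\ d o = y /\
    forall r, r < b -> r != o -> d r = c r.

Section MurecInd.
Variable P : murec -> Prop.
Hypotheses (PZ : P Zero) (PS : P Succ) (PP : forall i, P (Proj i))
  (PC : forall f gs, P f -> foldr (fun g => and (P g)) True gs -> P (Comp f gs))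
  (PR : forall f g, P f -> P g -> P (PrimRec f g))
  (PM : forall f, P f -> P (Mu f)).

(** [murec] is nested through [seq]; this induction principle also provides hypotheses for the
    arguments of [Comp]. *)
Fixpoint murec_rec (f : murec) : P f :=
  match f with
  | Zero => PZ
  | Succ => PS
  | Proj i => PP i
  | Comp f gs => PC (murec_rec f)
      ((fix all gs : foldr (fun g => and (P g)) True gs :=
          match gs with
          | [::] => I
          | g :: gs => conj (murec_rec g) (all gs)
          end) gs)
  | PrimRec f g => PR (murec_rec f) (murec_rec g)
  | Mu f => PM (murec_rec f)
  end.
End MurecInd.

Lemma map_frame (c d : nat -> nat) args b :
  all (fun r => r < b) args -> (forall r, r < b -> d r = c r) ->
  map d args = map c args.
Proof. by move=> /allP h e; apply/eq_in_map => r /h /e. Qed.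

Lemma eval_PrimRecS_inv f g k xs y : eval (PrimRec f g) (k.+1 :: xs) y ->
  exists2 r, eval (PrimRec f g) (k :: xs) r & eval g [:: k, r & xs] y.
Proof. move=> ev; inversion ev; subst; by eexists; eassumption. Qed.

Lemma eval_seq_cons_inv g gs xs zs : eval_seq (g :: gs) xs zs ->
  exists y ys, [/\ zs = y :: ys, eval g xs y & eval_seq gs xs ys].
Proof.
move=> ev; inversion ev; subst; do 2!eexists; by split; [reflexivity|eassumption..].
Qed.

Lemma eval_PrimRec_seq f g k xs y : eval (PrimRec f g) (k :: xs) y ->
  exists v : nat -> nat, [/\ eval f xs (v 0),
    forall i, i < k -> eval g [:: i, v i & xs] (v i.+1) & v k = y].
Proof.
elim: k y => [|k IH] y ev; first by inversion ev; subst; exists (fun=> y).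
have [r /IH[v [v0 vS vk]] ev'] := eval_PrimRecS_inv ev.
exists (fun i => if i == k.+1 then y else v i); split=> //; last by rewrite eqxx.
move=> i ik; rewrite eqSS ltn_eqF //.
by case: eqVneq ik => [-> _|ne ik]; rewrite ?vk //; apply: vS; lia.
Qed.

Ltac arith :=
  repeat match goal with
  | H := _ |- _ => clearbody H
  | H : forall _, _ |- _ => clear H
  | H : exec _ _ _ |- _ => clear H
  | H : map _ _ = _ |- _ => clear H
  | H : is_true (all _ _) |- _ => clear H
  | H : is_true (_ \notin _) |- _ => clear H
  | H : eval _ _ _ |- _ => clear H
  | H : compiled _ |- _ => clear H
  end; lia.

Lemma compileP f : compiled f.
Proof.
elim/murec_rec: f => [||i|f gs IHf IHgs|f g IHf IHg|f IHf] xs y ev args o b c ca hb ho ob.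
- inversion ev; subst; exists (upd c o 0); split; first exact: exec_clear (frefl _).
  by rewrite /upd eqxx; split=> // r _ /negbTE ->.
- inversion ev; subst.
  have [d [ed [do_ hd]]] := exec_fetch 0 c hb ho ob (leqnn b).
  exists (upd d o (d o).+1); split.
    by apply: exec_Seq ed _; apply: exec_Inc.
  rewrite /upd eqxx do_; split=> // r rb ro; by rewrite (negbTE ro) hd.
- inversion ev; subst; exact: exec_fetch.
- inversion ev as [| | |f' gs' xs' ys y' evs evf| | |]; subst f' gs' xs' y' => {ev}.
  have [d [ed [dys hd]]] : exists d, exec ((fix compiles gs k :=
        match gs with
        | [::] => clear o
        | g :: gs => CSeq (compile g args (b + k) (b + k).+1) (compiles gs k.+1)
        end) gs 0) c d /\ map d (iota (b + 0) (size gs)) = ys /\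
      forall r, r < b + 0 -> r != o -> d r = c r.
    elim: gs ys 0 c ca IHgs evs {IHf evf} => [|g gs IH] ys k c ca.
      move=> _ evs; inversion evs; subst; exists (upd c o 0).
      split; first exact: exec_clear (frefl _).
      by split=> // r _ ro; rewrite /upd (negbTE ro).
    move=> /= [Pg Pgs] /eval_seq_cons_inv[y' [ys' [-> evg evs]]].
    have hbk : all (fun r => r < (b + k).+1) args.
      by apply: sub_all hb => r; arith.
    have ok : b + k \notin args by apply/negP => /(allP hb); arith.
    have [d [ed [do_ hd]]] := Pg _ _ evg args (b + k) (b + k).+1 c ca hbk ok (ltnSn _).
    have cd : map d args = map c args.
      by apply: (map_frame hb) => r rb; apply: hd; arith.
    have [e [ee [eo he]]] := IH _ k.+1 d (etrans cd ca) Pgs evs.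
    exists e; split; first exact: exec_Seq ed ee.
    rewrite -addnS eo -do_ he; [|arith|arith]; split=> // r rk ro.
    by rewrite he ?hd //; arith.
  rewrite addn0 in dys hd.
  have hb' : all (fun r => r < b + size gs) (iota b (size gs)).
    by apply/allP => r; rewrite mem_iota; arith.
  have ho' : o \notin iota b (size gs) by rewrite mem_iota; arith.
  have ob' : o < b + size gs by arith.
  have [e [ee [eo he]]] := IHf _ _ evf _ _ _ _ dys hb' ho' ob'.
  exists e; split; first exact: exec_Seq ed ee.
  by split=> // r rb ro; rewrite he ?hd //; arith.
- have [k [xs' exs]] : exists k xs', xs = k :: xs' by inversion ev; eauto.
  rewrite {}exs in ev ca *; case: args ca hb ho => [//|a0 args] ca hb ho.
  have hb1 : all (fun r => r < b + 1) (a0 :: args) by apply: sub_all hb => r; arith.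
  have bn : b \notin a0 :: args by apply/negP => /(allP hb); arith.
  have [c1 [e1 [c1b h1]]] := 
    @exec_fetch (a0 :: args) 0 b (b + 4) (b + 1) c hb1 bn ltac:(arith) ltac:(arith).
  rewrite ca /= in c1b; have [v [v0 vS vk]] := eval_PrimRec_seq ev.
  have hbt : all (fun r => r < b) args by case/andP: hb.
  have ot : o \notin args by move: ho; rewrite inE negb_or => /andP[].
  have cargs s : (forall r, r < b -> r != o -> s r = c r) -> map s args = xs'.
    move=> hs; have <- : map c args = xs' by case: ca.
    apply/eq_in_map => r rin; apply: hs; first exact: (allP hbt).
    by apply: contraNneq ot => <-.
  have hb4 : all (fun r => r < b + 4) args by apply: sub_all hbt => r; arith.
  have nin x : b <= x -> x \notin args by move=> bx; apply/negP => /(allP hbt); arith.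
  have h1' : forall r, r < b -> r != o -> c1 r = c r by move=> r rb ro; apply: h1; arith.
  have [c2 [e2 [c2b h2]]] := 
    IHf _ _ v0 args (b + 1) (b + 4) c1 (cargs _ h1') hb4 (nin _ (leq_addr _ _)) ltac:(arith).
  pose c3 := upd c2 (b + 2) 0.
  rewrite /=; set w := CWhile b _.
  (* Invariant: after [i] of the [k] rounds, [m] rounds remain, [b + 1] holds [v i] and [b + 2]
     holds [i]. *)
  have loop m i s : i + m = k -> s b = m -> s (b + 1) = v i -> s (b + 2) = i ->
      (forall r, r < b -> r != o -> s r = c r) -> exists d,
      exec w s d /\ d (b + 1) = y /\
      forall r, r < b -> r != o -> d r = c r.
    elim: m i s => [|m IH] i s im sb s1 s2 hs.
      exists s; split; first exact: exec_While0.
      by rewrite s1 -vk -im addn0.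
    pose s' := upd s b m.
    have hs' r : r < b -> r != o -> s' r = c r.
      by move=> rb ro; rewrite /s' /upd ifN ?hs //; arith.
    have ms' : map s' [:: b + 2, b + 1 & args] = [:: i, v i & xs'].
      rewrite /= cargs // /s' /upd !ifN ?s1 ?s2 //; arith.
    have hbg : all (fun r => r < b + 4) [:: b + 2, b + 1 & args].
      by rewrite /= hb4; arith.
    have og : b + 3 \notin [:: b + 2, b + 1 & args].
      rewrite !inE !negb_or nin ?andbT; arith.
    have [t [et [t3 ht]]] := IHg _ _ (vS i ltac:(arith)) _ _ _ _ ms' hbg og ltac:(arith).
    pose t' := upd (upd t (b + 1) (t (b + 3))) (b + 4) 0.
    have t's r : r < b + 4 -> r != b + 1 -> r != b + 3 -> t' r = s' r.
      by move=> r4 r1 r3; rewrite /t' /upd ifN ?ifN ?ht //; arith.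
    have [d [ed [d1 hd]]] : exists d,
      exec w (upd t' (b + 2) (t' (b + 2)).+1) d /\ d (b + 1) = y /\
      forall r, r < b -> r != o -> d r = c r.
      apply: (IH i.+1); first arith.
      - by rewrite /upd ifN ?t's; try arith; rewrite /s' /upd eqxx.
      - rewrite /upd ifN; last arith.
        by rewrite /t' /upd eqxx ifN //; arith.
      - rewrite /upd eqxx t's; try arith.
        by rewrite /s' /upd ifN ?s2 //; arith.
      - by move=> r rb ro; rewrite /upd ifN ?t's ?hs' //; arith.
    exists d; split=> //; apply: exec_WhileS ed; first by rewrite sb.
    apply: (exec_Seq (d := s')); first by apply: exec_Dec; rewrite sb.
    apply: exec_Seq et _; apply: (exec_Seq (d := t')).
      by apply: exec_copy; arith.
    exact: exec_Inc (frefl _).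
  have [d [ed [d1 hd]]] : exists d,
      exec w c3 d /\ d (b + 1) = y /\
      forall r, r < b -> r != o -> d r = c r.
    apply: (loop k 0) => //.
    - by rewrite /c3 /upd ifN ?h2 ?c1b //; arith.
    - by rewrite /c3 /upd ifN //; arith.
    - by rewrite /c3 /upd eqxx.
    - by move=> r rb ro; rewrite /c3 /upd ifN ?h2 ?h1 //; arith.
  exists (upd (upd d o (d (b + 1))) (b + 2) 0); split.
    apply: exec_Seq e1 _; apply: exec_Seq e2 _; apply: (exec_Seq (d := c3)).
      exact: exec_clear (frefl _).
    by apply: exec_Seq ed _; apply: exec_copy; arith.
  rewrite /upd eqxx ifN; last arith.
  by split=> // r rb ro; rewrite !ifN ?hd //; arith.
- inversion ev as [| | | | | |f' xs' k v hlt h0]; subst f' xs' y => {ev}.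
  have hb2 : all (fun r => r < b + 2) (b :: args).
    by rewrite /=; apply/andP; split; [arith|apply: sub_all hb => r; arith].
  have nin : b + 1 \notin b :: args.
    rewrite inE negb_or; apply/andP; split; first arith.
    by apply/negP => /(allP hb); arith.
  have cargs s : (forall r, r < b -> r != o -> s r = c r) -> map s args = xs.
    move=> hs; rewrite -ca; apply/eq_in_map => r rin; apply: hs; first exact: (allP hb).
    by apply: contraNneq ho => <-.
  have run i s w : s b = i -> (forall r, r < b -> r != o -> s r = c r) ->
      eval f (i :: xs) w -> exists d,
      exec (compile f (b :: args) (b + 1) (b + 2)) s d /\ d (b + 1) = w /\ d b = i /\
      forall r, r < b -> r != o -> d r = c r.
    move=> sb hs ev.
    have ms : map s (b :: args) = i :: xs by rewrite /= sb cargs.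
    have [d [ed [d1 hd]]] := IHf _ _ ev _ _ _ _ ms hb2 nin ltac:(arith).
    exists d; split=> //; split=> //; split; first by rewrite hd //; arith.
    by move=> r rb ro; rewrite hd ?hs //; arith.
  pose c1 := upd c b 0.
  have hc1 r : r < b -> r != o -> c1 r = c r by move=> rb _; rewrite /c1 /upd ifN //; arith.
  (* For [j <= k] this is the value of [f] at [j]; it vanishes first at [k], where the loop
     stops. *)
  pose val j := if j < k then (v j).+1 else 0.
  have evv j : j <= k -> eval f (j :: xs) (val j).
    by rewrite /val leq_eqVlt => /orP[/eqP ->|lt]; rewrite ?ltnn // lt; apply: hlt.
  have loop m i s : i + m = k -> s b = i -> s (b + 1) = val i ->
      (forall r, r < b -> r != o -> s r = c r) -> exists d,
      exec (CWhile (b + 1) (CSeq (CInc b) (compile f (b :: args) (b + 1) (b + 2)))) s d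
      /\ d b = k /\ forall r, r < b -> r != o -> d r = c r.
    elim: m i s => [|m IH] i s im sb s1 hs.
      exists s; rewrite sb -im addn0; split=> //; apply: exec_While0 => //.
      by rewrite s1 /val ifN //; arith.
    pose s' := upd s b i.+1.
    have [d [ed [d1 [db hd]]]] := run i.+1 s' (val i.+1) ltac:(by rewrite /s' /upd eqxx)
       ltac:(by move=> r rb ro; rewrite /s' /upd ifN ?hs //; arith) (evv i.+1 ltac:(arith)).
    have [e [ee he]] := IH i.+1 d ltac:(arith) db d1 hd.
    exists e; split=> //; apply: exec_WhileS ee.
      by rewrite s1 /val ifT //; arith.
    by apply: exec_Seq ed; apply: exec_Inc; rewrite sb.
  have [d [ed [d1 [db hd]]]] :=
    run 0 c1 (val 0) ltac:(by rewrite /c1 /upd eqxx) hc1 (evv _ (leq0n _)).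
  have [e [ee [eb he]]] := loop k 0 d (add0n _) db d1 hd.
  exists (upd (upd e o (e b)) (b + 1) 0); split.
    apply: (exec_Seq (d := c1)); first exact: exec_clear (frefl _).
    by apply: exec_Seq ed _; apply: exec_Seq ee _; apply: exec_copy; arith.
  rewrite /upd eqxx eb ifN; last arith.
  by split=> // r rb ro; rewrite !ifN ?he //; arith.
Qed.

Definition input (R : finType) (r0 : R) (x : nat) : store R :=
  fun r => if r == r0 then x else 0.

(** Nothing is claimed where [f] is undefined: the diagonal argument uses the machine at a single
    input, where the decider has to answer. *)
Theorem counter_machine (f : murec) :
  exists (R L : finType) (prog : L -> instr R L) (l0 : L) (r0 : R),
  forall x y, eval f [:: x] y -> (halts prog (l0, input r0 x) <-> y = 0).
Proof.
pose N := maxn 1 (bound (compile f [:: 0] 1 2)).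
pose c := cmap (@inord N) (compile f [:: 0] 1 2).
pose X := option (option (lab c)).
pose emb (l : lab c) : X := Some (Some l).
(* After [c], loop forever unless the output register is zero. *)
pose prog (l : X) : instr 'I_N.+1 X :=
  match l with
  | None => Halt _ _
  | Some None => Test (inord 1) None (Some None)
  | Some (Some l) => code emb (Some None) l
  end.
exists 'I_N.+1, X, prog, (emb (entry c)), (inord 0) => x y ev.
have [d [ed [d1 _]]] := compileP ev (args := [:: 0]) (o := 1) (b := 2)
  (c := fun r => if r == 0 then x else 0) erefl isT isT isT.
have init : input (inord 0 : 'I_N.+1) x =1 (fun r => if val r == 0 then x else 0).
  by move=> r; rewrite /input -val_eqE /= inordK.
have [k [t [td e]]] := exec_code (exec_cmap ed (leq_maxr 1 _)) (fun l => erefl)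
  init (prog := prog) (emb := emb) (x := Some None).
rewrite -(@halts_iter _ _ _ _ k) e.
have t1 : t (inord 1) = y by rewrite td /= inordK // ltnS leq_maxl.
split=> [[m]|y0].
  case: y t1 {ev d1} => // y t1.
  suff -> : iter m (step prog) (Some None, t) = (Some None, t) by [].
  by elim: m => //= m ->; rewrite /step /= t1.
by exists 1; rewrite /= /step /= t1 y0.
Qed.

(** * The game *)

Lemma foldl_map2 (S A B M : Type) (f : M -> A -> M) (g : M -> B -> M)
    (h : S -> A) (k : S -> B) : (forall m s, f m (h s) = g m (k s)) ->
  forall m w, foldl f m (map h w) = foldl g m (map k w).
Proof. by move=> e m w; elim: w m => //= s w IH m; rewrite e IH. Qed.

Section Game.
Variables (R L : finType) (prog : L -> instr R L) (l0 : L) (r0 : R).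

Definition tile : finType := (option L * {ffun R -> bool})%type.

(* The column i of a check: [Some false] if i = 0, [Some true] if i = x + 1 is known
   from the corridor, [None] otherwise. *)
Definition zone := option bool.

(* [u] and [v] are the bits at columns i and i + 1.  Monotonicity together with the
   drop after column x + 1 gives register [r0] the value x + 2. *)
Definition init_ok (z : zone) (u v : {ffun R -> bool}) : bool :=
  [forall r, if r == r0
             then (v r ==> u r) && ((z == Some true) ==> u r && ~~ v r)
             else ~~ u r].

(* [p1], [p2] are the tiles (i, k), (i + 1, k) and [c1], [c2] the tiles (i, k + 1),
   (i + 1, k + 1): row k + 1 precedes row k in the run.  Incrementing shifts the bits
   of a register to the right, decrementing to the left; only column 0 sees whether
   a register is zero. *)
Definition step_ok (z : zone) (p1 p2 c1 c2 : tile) : bool :=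
  (c1.1 == c2.1) &&
  match c1.1 with
  | None => [&& (p1.1 == None) || (p1.1 == Some l0), p1.2 == c1.2 &
             init_ok z c1.2 c2.2]
  | Some l =>
    match prog l with
    | Inc r l' => [&& p1.1 == Some l', p2.2 r == c1.2 r,
        (z == Some false) ==> p1.2 r & [forall s, (s != r) ==> (p1.2 s == c1.2 s)]]
    | Dec r l' => [&& p1.1 == Some l', p1.2 r == c2.2 r &
        [forall s, (s != r) ==> (p1.2 s == c1.2 s)]]
    | Test r l1 l2 => (p1.2 == c1.2) &&
        ((z == Some false) ==> (p1.1 == Some (if c1.2 r then l2 else l1)))
    | Halt => false
    end
  end.

Definition halted (t : tile) : bool :=
  if t.1 is Some l then (if prog l is Halt then true else false) else false.

Definition row0_ok (c1 c2 : tile) : bool := (c1.1 == c2.1) && halted c1.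

(* The boolean records whether the previous check failed.  [SRun]: both players are in
   a^i; [SStep]: same word, [p1] and [p2] are the previous answers; [SEq0], [SEq]: player
   1 is one a ahead and [p] is the previous answer of player 2; [inr k]: corridor. *)
Definition bstate : finType := ((zone * (tile * tile) + tile) * bool)%type.
Definition fstate : finType := (unit + (bstate + (tile * bool + bool)))%type.
Definition gstate (x : nat) : finType := (fstate + 'I_x.+1)%type.

Definition SStart {x} : gstate x := inl (inl tt).
Definition SStep {x} z p1 p2 b : gstate x := inl (inr (inl (inl (z, (p1, p2)), b))).
Definition SEq {x} p b : gstate x := inl (inr (inl (inr p, b))).
Definition SEq0 {x} p b : gstate x := inl (inr (inr (inl (p, b)))).
Definition SRun {x} b : gstate x := inl (inr (inr (inr b))).

Definition check x (s : gstate x) (c1 c2 : tile) : bool :=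
  match s with
  | inl (inl _) => row0_ok c1 c2
  | inl (inr (inl (inl (z, (p1, p2)), _))) => step_ok z p1 p2 c1 c2
  | inl (inr (inl (inr p, _))) => c1 == p
  | inl (inr (inr (inl (p, _)))) => c1 == p
  | inl (inr (inr (inr _))) => row0_ok c1 c2
  | inr _ => true
  end.

Definition next x (s : gstate x) (c1 c2 : tile) (e : bool * bool) : gstate x :=
  let bad := ~~ check s c1 c2 in
  match s with
  | inl (inl _) =>
      match e with
      | (false, false) => SRun bad
      | (true, false) => SStep (Some false) c1 c2 bad
      | (false, true) => SEq0 c2 bad
      | (true, true) => inr ord0
      end
  | inl (inr (inl (inl (z, _), _))) => SStep z c1 c2 bad
  | inl (inr (inl (inr _, _))) => SEq c2 bad
  | inl (inr (inr (inl _))) => SEq c2 bad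
  | inl (inr (inr (inr _))) =>
      match e with
      | (true, false) => SStep None c1 c2 bad
      | (false, true) => SEq0 c2 bad
      | _ => SRun bad
      end
  | inr k => if k < x then inr (inord k.+1) else SStep (Some true) c1 c2 false
  end.

(* [None] starts a word, [Some false] is the letter a and [Some true] the letter b. *)
Definition letter (x : nat) (first : bool) (s : gstate x) : option bool :=
  match s with
  | inl (inl _) => None
  | inl (inr (inl _)) => Some true
  | inl (inr (inr (inl _))) => Some (~~ first)
  | inl (inr (inr (inr _))) => Some false
  | inr _ => Some false
  end.

Definition bad (x : nat) (s : gstate x) : bool :=
  match s with
  | inl (inr (inl (_, b))) => b
  | inl (inr (inr (inl (_, b)))) => b
  | inl (inr (inr (inr b))) => b
  | _ => false
  end.

Lemma check_next x (s : gstate x) c1 c2 e :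
  check s c1 c2 -> ~~ bad (next s c1 c2 e).
Proof.
case: s => [[[]|[[[[z [p1 p2]]|p] b]|[[p b]|b]]]|k];
  case: e => [[] []] //=; rewrite ?negbK //; by case: (k < x).
Qed.

(** [(true, true)] is excluded because entering the corridor from [SStart] drops the result of the
    check. *)
Lemma next_check x (s : gstate x) c1 c2 e : e != (true, true) ->
  ~~ bad (next s c1 c2 e) -> check s c1 c2.
Proof.
case: s => [[[]|[[[[z [p1 p2]]|p] b]|[[p b]|b]]]|k];
  case: e => [[] []] //=; rewrite ?negbK //.
Qed.

(** * Pictures that satisfy all local checks *)

Section Rows.
Variables (x : nat) (f : nat -> nat -> tile).
Hypotheses (f0 : forall i, row0_ok (f i 0) (f i.+1 0))
  (fS : forall i k, step_ok (if i == 0 then Some false else None)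
          (f i k) (f i.+1 k) (f i k.+1) (f i.+1 k.+1))
  (fB : forall k, step_ok (Some true)
          (f x.+1 k) (f x.+2 k) (f x.+1 k.+1) (f x.+2 k.+1)).

Lemma row_label i k : (f i k).1 = (f 0 k).1.
Proof.
elim: i => // i <-; symmetry; apply/eqP.
by case: k => [|k]; [have /andP[] := f0 i | have /andP[] := fS i k].
Qed.

Lemma row_live k l : (f 0 k.+1).1 = Some l -> prog l <> Halt _ _.
Proof. by move=> e h; have := fS 0 k; rewrite /step_ok e h andbF. Qed.

(* The successor of a row of tiles, in the direction of decreasing index. *)
Definition succ_row (l : L) (rho : nat -> tile) (i : nat) : tile :=
  match prog l with
  | Inc r l' => (Some l', [ffun s => if s == r then
       (if i is i'.+1 then (rho i').2 r else true) else (rho i).2 s])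
  | Dec r l' => (Some l', [ffun s => if s == r then (rho i.+1).2 r else (rho i).2 s])
  | Test r l1 l2 => (Some (if (rho 0).2 r then l2 else l1), (rho i).2)
  | Halt => rho i
  end.

(** The block at column [i] determines the tile with two exceptions: an incremented bit at a column
    [i > 0] comes from the block to its left, and the label after a test from the block at column
    0. *)
Lemma row_succ k l i : (f 0 k.+1).1 = Some l ->
  f i k = succ_row l (fun i => f i k.+1) i.
Proof.
move=> e; have live := row_live e.
rewrite [LHS]surjective_pairing row_label /succ_row.
have lE j : (f j k.+1).1 = Some l by rewrite row_label.
have := fS i k; have h0 := fS 0 k; move: h0; rewrite /step_ok !lE eqxx /=.
case El: (prog l) => [r l'|r l'|r l1 l2|] //.
- move=> /and4P[/eqP -> _ /= h0 _] /and4P[_ _ _ /forallP h]; congr pair.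
  apply/ffunP => s; rewrite ffunE; case: eqVneq => [->|sr]; last first.
    by have := h s; rewrite sr => /eqP.
  case: i {h} => [//|i].
  by have := fS i k; rewrite /step_ok !lE eqxx El /= => /and4P[_ /eqP].
- move=> /and3P[/eqP -> _ _] /and3P[_ /eqP h1 /forallP h]; congr pair.
  apply/ffunP => s; rewrite ffunE; case: eqVneq => [->|sr] //.
  by have := h s; rewrite sr => /eqP.
- by move=> /andP[_ /eqP ->] /andP[/eqP -> _].
Qed.

Lemma rows_agree k m l : (f 0 k.+1).1 = Some l ->
  (forall i, f i k.+1 = f i m.+1) -> forall i, f i k = f i m.
Proof.
move=> e h i; have e' : (f 0 m.+1).1 = Some l by rewrite -h.
rewrite (row_succ i e) (row_succ i e') /succ_row.
by case: (prog l) => [r l'|r l'|r l1 l2|]; rewrite ?h //; case: i => [|i]; rewrite ?h.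
Qed.

Definition encodes (k : nat) (q : L * store R) : Prop :=
  forall i, f i k = (Some q.1, [ffun r => i < q.2 r]).

Lemma encodes_step k q : encodes k.+1 q -> encodes k (step prog q).
Proof.
move=> h i; have e : (f 0 k.+1).1 = Some q.1 by rewrite h.
have live := row_live e.
rewrite (row_succ i e) /succ_row /step.
case El: (prog q.1) => [r l'|r l'|r l1 l2|] //=; congr pair.
- apply/ffunP => s; rewrite !ffunE /upd; case: eqVneq => _; last by rewrite h ffunE.
  by case: i => [//|i]; rewrite h ffunE ltnS.
- apply/ffunP => s; rewrite !ffunE /upd; case: eqVneq => _; last by rewrite h ffunE.
  by rewrite h ffunE; lia.
- by rewrite h ffunE /= lt0n; case: eqP.
- by rewrite h.
Qed.

(** Going down one row is one machine step, and row 0 carries a halting label. *)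
Lemma encodes_halts k q : encodes k q -> halts prog q.
Proof.
elim: k q => [|k IH] q h.
  exists 0; have /andP[_] := f0 0; rewrite h /halted /=.
  by case: (prog q.1).
by have := IH _ (encodes_step h); rewrite (@halts_iter _ _ _ _ 1).
Qed.

Lemma init_row k : (f 0 k.+1).1 = None -> (f 0 k).1 <> None ->
  encodes k (l0, input r0 x.+2).
Proof.
move=> e ne i.
have eE j : (f j k.+1).1 = None by rewrite row_label.
have keep j : f j k = (Some l0, (f j k.+1).2).
  rewrite [LHS]surjective_pairing row_label.
  have := fS 0 k; rewrite /step_ok !eE /= => /and3P[/orP[/eqP/ne//|/eqP -> _ _]].
  by have := fS j k; rewrite /step_ok !eE /= => /and3P[_ /eqP ->].
rewrite keep; congr pair; apply/ffunP => r; rewrite ffunE /input.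
have ini j : init_ok (if j == 0 then Some false else None) (f j k.+1).2 (f j.+1 k.+1).2.
  by have := fS j k; rewrite /step_ok !eE /= => /and3P[].
case: (eqVneq r r0) => [->|ne0]; last first.
  by have /forallP/(_ r) := ini i; rewrite (negbTE ne0) => /negbTE ->; rewrite /= (negbTE ne0).
have mono a b : a <= b -> (f b k.+1).2 r0 -> (f a k.+1).2 r0.
  move=> /subnK <-; elim: (b - a) => // m IH h; apply: IH.
  have /forallP/(_ r0) := ini (m + a); rewrite eqxx => /andP[/implyP im _].
  exact: im.
(* The block at column [x + 1] exhibits the drop: the bit of [r0] is set at [x + 1] and clear at
   [x + 2]. *)
have := fB k; rewrite /step_ok !eE /= => /and3P[_ _ /forallP/(_ r0)].
rewrite eqxx => /andP[_ /andP[b1 b2]].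
rewrite /=; case: (ltnP i x.+2) => ix; first by apply: mono b1; lia.
by apply: contraNF b2; apply: mono.
Qed.

Lemma rows_halts S S' : S < S' -> (forall i, f i S = f i S') ->
  halts prog (l0, input r0 x.+2).
Proof.
move=> SS per.
have h0 : (f 0 0).1 <> None.
  by have /andP[_] := f0 0; rewrite /halted; case: (f 0 0).1.
have exN : exists k, (f 0 k).1 == None.
  case: (boolP [exists k : 'I_S'.+1, (f 0 k).1 == None]) => [/existsP[k]|].
    by exists k.
  rewrite negb_exists => /forallP all_some; exfalso.
  (* Without a row labelled [None], equality of rows [S] and [S'] descends to rows 0 and
     [S' - S]. *)
  have down m : m <= S -> forall i, f i (S - m) = f i (S' - m).
    elim: m => [|m IH] mS; first by rewrite !subn0.
    have := all_some (inord (S - m)); rewrite inordK; last by lia.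
    have -> : S - m = (S - m.+1).+1 by lia.
    case e: (f 0 _).1 => [l|] // _; apply: (rows_agree e).
    have <- : S - m = (S - m.+1).+1 by lia.
    have <- : S' - m = (S' - m.+1).+1 by lia.
    by apply: IH; lia.
  have := down S (leqnn S) 0; rewrite subnn.
  have -> : S' - S = (S' - S).-1.+1 by lia.
  (* Row 0 is halting, but by [row_live] no later row is. *)
  move=> e; have /andP[_] := f0 0; rewrite /halted.
  case el: (f 0 0).1 => [l|] //; rewrite e in el.
  by move: (row_live el); case: (prog l).
(* The least row labelled [None] is not row 0, so it has a predecessor [m], which encodes the
   initial configuration. *)
case: (ex_minnP exN) => -[/eqP //|m /eqP mN mmin].
apply: (@encodes_halts m); apply: init_row => // /eqP e.
by have := mmin _ e; rewrite ltnn.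
Qed.
End Rows.

(** * The game structure for [n + 3] players *)

Section Arena.
Variables (n x : nat).

(* The team answers with the tile, player 3 chooses the branch with the booleans. *)
Definition action : finType := (tile * (bool * bool))%type.
Definition player1 : 'I_n.+3 := @Ordinal n.+3 0 isT.
Definition player2 : 'I_n.+3 := @Ordinal n.+3 1 isT.
Definition player3 : 'I_n.+3 := @Ordinal n.+3 2 isT.

Lemma player2_neq1 : (player2 == player1) = false.
Proof. by []. Qed.

Definition tab (s : gstate x)
  (m : {a : n.+3.-tuple action | is_move (fun=> [set: action]) a}) : gstate x :=
  next s (tnth (val m) player1).1 (tnth (val m) player2).1 (tnth (val m) player3).2.

Definition same (j : 'I_n.+3) (s t : gstate x) : bool :=
  letter (j == player1) s == letter (j == player1) t.

Lemma same_equiv j : equivalence_rel (same j).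
Proof. by split=> [|/eqP e]; rewrite /same ?e. Qed.

Definition default_tile : tile := (None, [ffun=> false]).

Lemma gstate_gt0 : 0 < #|gstate x|.
Proof. by apply/card_gt0P; exists SStart. Qed.

Lemma action_gt0 : 0 < #|action|.
Proof. by apply/card_gt0P; exists (default_tile, (false, false)). Qed.

Lemma moves_neq0 (s : gstate x) (j : 'I_n.+3) : [set: action] != set0.
Proof. by apply/set0Pn; exists (default_tile, (false, false)); rewrite inE. Qed.

Definition arena : iCGS n.+3 :=
  @ICGS n.+3 (gstate x) gstate_gt0 action action_gt0 (fun _ _ => [set: action])
    moves_neq0 tab same same_equiv (fun _ _ _ _ => erefl).

Definition arena_model (AP : finType) : iCGM n.+3 AP :=
  @ICGM n.+3 AP arena (fun s => if bad s then [set: AP] else set0).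

Lemma tab_next (s : State arena) (a : n.+3.-tuple action) :
  exists m : move s, val m = a /\
    Tab m = next s (tnth a player1).1 (tnth a player2).1 (tnth a player3).2.
Proof.
have am : is_move (@Mov _ arena s) a by apply/forallP => j; rewrite inE.
by exists (exist _ a am).
Qed.

Definition team : {set 'I_n.+3} := [set player1; player2].

Definition safe (s : State arena) : Prop :=
  can_enforce team (fun rho : nat -> State arena => forall k, ~~ @bad x (rho k)) s.

(** A representative whose letter is [o] whatever the player: observation sets are named by their
    letters. *)
Definition letter_state (o : option bool) : gstate x :=
  match o with
  | None => SStart
  | Some false => SRun false
  | Some true => SEq default_tile false
  end.

Definition letter_obs (j : 'I_n.+3) (o : option bool) : obs arena j :=
  obs_of (G := arena) j (letter_state o).

Lemma obs_of_letter (j : 'I_n.+3) (s : State arena) :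
  obs_of j s = letter_obs j (letter (j == player1) s).
Proof.
apply: val_inj; apply/setP => t; rewrite !inE /= /same; congr (_ == _).
by case: (letter _ s) => [[]|].
Qed.

(** The letter at time [t] of the start mark followed by a^i and then b forever. *)
Definition query (i t : nat) : option bool := if t == 0 then None else Some (i < t).

(** * From a winning strategy to a halting run *)

Section Sound.
Variable sigma : forall j, strategy arena j.
Hypothesis safe_sigma : forall rho, Out (SStart : State arena) team sigma rho ->
  forall k, ~~ @bad x (rho k).

(* The answer of player [j] to a^i b^(t - i), or to a^t if t <= i. *)
Definition response (j : 'I_n.+3) (i t : nat) : tile :=
  (@sigma j [seq letter_obs j o | o <- mkseq (query i) t.+1]).1.

Section Play.
Variables (i1 i2 : nat) (e : nat -> bool * bool).

(** The answers are those to two words fixed beforehand; the play is an outcome of [sigma] once its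
    states are shown to ask these words, which is [l1] and [l2]. *)
Fixpoint play (t : nat) : gstate x :=
  if t is t'.+1 then next (play t') (response player1 i1 t') (response player2 i2 t') (e t')
  else SStart.

Lemma playS t : play t.+1 =
  next (play t) (response player1 i1 t) (response player2 i2 t) (e t).
Proof. by []. Qed.

Hypotheses (l1 : forall t, letter true (play t) = query i1 t)
  (l2 : forall t, letter false (play t) = query i2 t).

Lemma play_history1 t : obs_history (G := arena) player1 play t =
  [seq letter_obs player1 o | o <- mkseq (query i1) t.+1].
Proof.
rewrite /obs_history /mkseq -!map_comp; apply/eq_map => u.
by rewrite /comp obs_of_letter eqxx l1.
Qed.

Lemma play_history2 t : obs_history (G := arena) player2 play t =
  [seq letter_obs player2 o | o <- mkseq (query i2) t.+1].
Proof.
rewrite /obs_history /mkseq -!map_comp; apply/eq_map => u.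
by rewrite /comp obs_of_letter player2_neq1 l2.
Qed.

Lemma play_Out : Out (SStart : State arena) team sigma play.
Proof.
split=> // t.
pose a := [tuple (if j \in team then @sigma j (obs_history (G := arena) j play t)
                  else (default_tile, e t)) | j < n.+3].
have [m [ma mt]] := tab_next (play t) a.
exists m; rewrite mt ma !tnth_mktuple !inE /= play_history1 play_history2.
by split=> // j jA; rewrite tnth_mktuple jA.
Qed.

Lemma play_check t : e t != (true, true) ->
  check (play t) (response player1 i1 t) (response player2 i2 t).
Proof. move=> et; exact: next_check et (safe_sigma play_Out t.+1). Qed.
End Play.

Section Plans.
Variables (i i1 i2 : nat) (e : nat -> bool * bool).
Hypothesis e_run : forall t, t < i -> e t = (false, false).

Lemma play_run t : t <= i -> exists b,
  play i1 i2 e t = if t == 0 then SStart else SRun b.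
Proof.
elim: t => [|t IH] ti; first by exists true.
have [b /= ->] := IH (ltnW ti); rewrite e_run //.
by case: t {IH ti} => [|t]; eexists.
Qed.

Lemma play_step j : e i = (true, false) -> exists b, play i1 i2 e (i + j).+1 =
  SStep (if i == 0 then Some false else None)
    (response player1 i1 (i + j)) (response player2 i2 (i + j)) b.
Proof.
move=> ei; elim: j => [|j [b IH]].
  rewrite addn0 /=; have [b ->] := play_run (leqnn i); rewrite ei.
  by case: (i == 0); eexists.
by rewrite addnS playS IH; eexists.
Qed.

Lemma play_eq0 : e i = (false, true) -> exists b,
  play i1 i2 e i.+1 = SEq0 (response player2 i2 i) b.
Proof.
move=> ei /=; have [b ->] := play_run (leqnn i); rewrite ei.
by case: (i == 0); eexists.
Qed.

Lemma play_eq j : e i = (false, true) -> exists b,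
  play i1 i2 e (i + j).+2 = SEq (response player2 i2 (i + j).+1) b.
Proof.
move=> ei; elim: j => [|j [b IH]].
  rewrite addn0 playS.
  by have [b ->] := play_eq0 ei; eexists.
by rewrite addnS playS IH; eexists.
Qed.

Lemma play_chain k : e 0 = (true, true) -> k <= x ->
  play i1 i2 e k.+1 = inr (inord k).
Proof.
move=> e0; elim: k => [|k IH] kx.
  by rewrite /= e0; congr inr; apply: val_inj; rewrite /= inordK.
rewrite playS (IH (ltnW kx)) /= inordK ?kx //.
by rewrite ltnS ltnW.
Qed.

Lemma play_bound j : e 0 = (true, true) -> exists b, play i1 i2 e (x.+1 + j).+1 =
  SStep (Some true) (response player1 i1 (x.+1 + j)) (response player2 i2 (x.+1 + j)) b.
Proof.
move=> e0; elim: j => [|j [b IH]].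
  rewrite addn0 playS play_chain //=.
  by rewrite inordK // ltnn; eexists.
by rewrite addnS playS IH; eexists.
Qed.
End Plans.

(** Position 0 is the start mark, so at time [i + k] the word read is a^i b^k. *)
Definition cell (j : 'I_n.+3) (i k : nat) : tile := response j i (i + k).

Lemma query_le i t : t <= i -> query i t = if t == 0 then None else Some false.
Proof. by move=> ti; rewrite /query ltnNge ti. Qed.

Lemma query_gt i t : i < t -> query i t = Some true.
Proof. by move=> it; rewrite /query it; case: t it. Qed.

Lemma gt_witness i t : i < t -> exists j, t = (i + j).+1.
Proof. by move=> it; exists (t - i.+1); lia. Qed.

(** Plans of player 3: leave the a-phase at time [i] for a step check or an equality check, or enter
    the corridor at once. The branches ignore later choices, but [play_check] needs a choice other
    than [(true, true)] at the checked time. *)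
Definition e_step i t := (i <= t, false).
Definition e_eq i t := (false, i <= t).
Definition e_bound t := (t == 0, t == 0).

Lemma e_step_run i t : t < i -> e_step i t = (false, false).
Proof. by move=> ti; rewrite /e_step leqNgt ti. Qed.

Lemma e_step_ok i t : e_step i t != (true, true).
Proof. by rewrite xpair_eqE andbF. Qed.

Lemma e_eq_run i t : t < i -> e_eq i t = (false, false).
Proof. by move=> ti; rewrite /e_eq leqNgt ti. Qed.

Lemma letter_step b i t : letter b (play i i (e_step i) t) = query i t.
Proof.
case: (leqP t i) => [ti|/[dup] it /gt_witness[j ->]].
  have [c ->] := play_run i i (@e_step_run i) ti.
  by rewrite query_le //; case: eqP.
have [c ->] := play_step i i (@e_step_run i) j (congr1 (pair^~ false) (leqnn i)).
by rewrite query_gt //; lia.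
Qed.

Lemma letter_eq b i t : letter b (play i.+1 i (e_eq i) t) = query (b + i) t.
Proof.
have ei : e_eq i i = (false, true) by rewrite /e_eq leqnn.
case: (ltngtP t i.+1) => [ti|/gt_witness[j ->]|->].
- have [c ->] := play_run i.+1 i (@e_eq_run i) ti.
  by rewrite query_le; [case: eqP | lia].
- have [c ->] := play_eq i.+1 i (@e_eq_run i) j ei.
  by rewrite query_gt //; case: b; lia.
- have [c ->] := play_eq0 i.+1 i (@e_eq_run i) ei.
  by case: b; rewrite /query /= ?ltnn ?ltnSn.
Qed.

Lemma letter_bound b t : letter b (play x.+1 x.+1 e_bound t) = query x.+1 t.
Proof.
case: (leqP t x.+1) => [|/[dup] it /gt_witness[j ->]].
  case: t => // t tx; by rewrite play_chain ?query_le.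
have [c ->] := play_bound x.+1 x.+1 j (erefl (e_bound 0)).
by rewrite query_gt //; lia.
Qed.

Lemma cell_row0 i : row0_ok (cell player1 i 0) (cell player2 i 0).
Proof.
have := @play_check i i (e_step i) (letter_step _ i) (letter_step _ i) i (e_step_ok i i).
rewrite /cell addn0; have [b ->] := play_run i i (@e_step_run i) (leqnn i).
by case: eqP.
Qed.

Lemma cell_step i k : step_ok (if i == 0 then Some false else None)
  (cell player1 i k) (cell player2 i k) (cell player1 i k.+1) (cell player2 i k.+1).
Proof.
have := @play_check i i (e_step i) (letter_step _ i) (letter_step _ i) (i + k).+1.
have [b ->] := play_step i i (@e_step_run i) k (congr1 (pair^~ false) (leqnn i)).
by rewrite /cell addnS; apply; apply: e_step_ok.
Qed.

Lemma cell_bound k : step_ok (Some true)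
  (cell player1 x.+1 k) (cell player2 x.+1 k) (cell player1 x.+1 k.+1) (cell player2 x.+1 k.+1).
Proof.
have := @play_check x.+1 x.+1 e_bound (letter_bound _) (letter_bound _) (x.+1 + k).+1.
have [b ->] := play_bound x.+1 x.+1 k (erefl (e_bound 0)).
by rewrite /cell addnS; apply.
Qed.

(** Player 1 is asked a word one letter longer, so its answer at time [i + k + 1] is compared with
    the answer that player 2 gave one step earlier. *)
Lemma cell_eq i k : cell player1 i.+1 k = cell player2 i k.
Proof.
have := @play_check i.+1 i (e_eq i) (letter_eq true i) (letter_eq false i) (i.+1 + k).
have ei : e_eq i i = (false, true) by rewrite /e_eq leqnn.
rewrite /cell; case: k => [|k].
  rewrite !addn0; have [b ->] := play_eq0 i.+1 i (@e_eq_run i) ei.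
  by move=> h; apply/eqP/h.
rewrite addSn addnS; have [b ->] := play_eq i.+1 i (@e_eq_run i) k ei.
by move=> h; apply/eqP/h.
Qed.

(* The answers in row k + 1 depend on the k-th iterate of one map on memory states,
   whatever the column, and two of these iterates coincide. *)
Lemma cell_regular (T : transducer (obs arena player1) action) :
  realizes T (@sigma player1) -> exists S S', S < S' /\
  forall i, cell player1 i S = cell player1 i S'.
Proof.
move=> real; pose B := letter_obs player1 (Some true).
pose m i := foldl (@trans _ _ T) (mem0 T) [seq letter_obs player1 o | o <- mkseq (query i) i.+1].
pose beta u := trans (t := T) u B.
(* The last b is the current observation and not yet in memory, so row [k + 1] sees [k] applications
   of [beta]. *)
have cellE i k : cell player1 i k.+1 = (out (t := T) (iter k beta (m i)) B).1.
  have lt := letter_step true i; have lf := letter_step false i.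
  have [_ outc] := play_Out lt lf.
  rewrite /cell /response -(play_history1 lt) real; last first.
    by move=> t; have [mv [e _]] := outc t; exists mv.
  rewrite obs_of_letter eqxx lt addnS query_gt; last by lia.
  congr (out _ _).1.
  have -> : [seq obs_of (G := arena) player1 s | s <- mkseq (play i i (e_step i)) (i + k).+1]
      = [seq letter_obs player1 o | o <- mkseq (query i) (i + k).+1].
    exact: (play_history1 lt).
  elim: k => [|k IH]; first by rewrite addn0.
  by rewrite addnS mkseqS map_rcons foldl_rcons IH query_gt //; lia.
pose g (k : 'I_#|{ffun memory T -> memory T}|.+1) := [ffun u => iter k beta u].
case: (boolP (injectiveb g)) => [/injectiveP/leq_card|/injectivePn[a [b ab gab]]].
  by rewrite card_ord ltnn.
have per i : cell player1 i a.+1 = cell player1 i b.+1.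
  by rewrite !cellE; have /ffunP/(_ (m i)) := gab; rewrite !ffunE => ->.
case: (ltngtP a b) => [lt|gt|e].
- by exists a.+1, b.+1.
- by exists b.+1, a.+1; split=> // i; rewrite per.
- by case/eqP: ab; apply: val_inj.
Qed.

End Sound.

Lemma safe_halts : safe SStart -> halts prog (l0, input r0 x.+2).
Proof.
case=> sigma [fin win].
have in1 : player1 \in team by rewrite !inE eqxx.
have ss rho : Out (SStart : State arena) team sigma rho -> forall k, ~~ @bad x (rho k).
  by apply: win in1 _ _ _; rewrite /indis /= /same eqxx.
have [_ [T real]] := fin _ in1.
have [S [S' [SS per]]] := cell_regular real.
(* [cell_eq] rewrites the tiles of player 2 as tiles of player 1, and one picture passes all
   checks. *)
apply: (@rows_halts x (cell sigma player1)) SS per => [i|i k|k].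
- by have := cell_row0 ss i; rewrite -(cell_eq ss).
- by have := cell_step ss i k; rewrite -!(cell_eq ss).
- by have := cell_bound ss k; rewrite -!(cell_eq ss).
Qed.
End Arena.

(** * From a halting run to a winning strategy *)

Section Run.
Variables (x T : nat).
Let q0 := (l0, input r0 x.+2).
Let run t := iter t (step prog) q0.
Hypotheses (haltT : prog (run T).1 = Halt _ _)
  (liveT : forall t, t < T -> prog (run t).1 <> Halt _ _).

(** Row [k] shows time [T - k]; rows beyond [T] keep the bits of the initial store, as [step_ok]
    demands before the run starts. *)
Definition tile_at (i k : nat) : tile :=
  if k <= T then (Some (run (T - k)).1, [ffun r => i < (run (T - k)).2 r])
  else (None, [ffun r => i < q0.2 r]).

Lemma tile_at_row0 i j : row0_ok (tile_at i 0) (tile_at j 0).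
Proof. by rewrite /row0_ok /halted /tile_at subn0 /= eqxx haltT. Qed.

Lemma tile_at_init z i : (z = Some true -> i = x.+1) ->
  init_ok z [ffun r => i < q0.2 r] [ffun r => i.+1 < q0.2 r].
Proof.
move=> hz; apply/forallP => r; rewrite !ffunE /= /input.
case: eqP => // _; apply/andP; split; first by apply/implyP; lia.
by apply/implyP => /eqP/hz ->; lia.
Qed.

Lemma tile_at_step z i k : (z = Some false -> i = 0) ->
  (z = Some true -> i = x.+1) ->
  step_ok z (tile_at i k) (tile_at i.+1 k) (tile_at i k.+1) (tile_at i.+1 k.+1).
Proof.
move=> zf zt; rewrite /step_ok /tile_at; case: (ltngtP k T) => [kT|kT|->] /=.
- have -> : run (T - k) = step prog (run (T - k.+1)).
    by rewrite -[RHS]/(run (T - k.+1).+1) -subSn // subSS.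
  have := @liveT (T - k.+1); rewrite eqxx /= /step.
  case: (run _) => l s /=; case: (prog l) => [r l'|r l'|r l1 l2|] /= live.
  + rewrite eqxx !ffunE /upd eqxx ltnS eqxx /=; apply/andP; split.
      by apply/implyP => /eqP/zf ->.
    by apply/forallP => u; rewrite !ffunE; case: eqVneq => //= _; rewrite eqxx.
  + rewrite eqxx !ffunE /upd eqxx /=; apply/andP; split; first by apply/eqP; lia.
    by apply/forallP => u; rewrite !ffunE; case: eqVneq => //= _; rewrite eqxx.
  + rewrite eqxx /=; apply/implyP => /eqP/zf ->; rewrite ffunE lt0n.
    by case: (s r == 0).
  + by case: live => //; lia.
- by rewrite eqxx tile_at_init.
- by rewrite subnn /= !eqxx tile_at_init.
Qed.

(** A register grows by at most one per step, so its value never exceeds [B] during the run and all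
    columns from [B] on look alike. *)
Let B := x.+2 + T.

Lemma run_bound t r : (run t).2 r <= x.+2 + t.
Proof.
elim: t r => [|t IH] r; first by rewrite addn0 /= /input; case: eqP.
rewrite /run iterS -/(run t) {1}/step; have := IH r.
case: (prog _) => [u l'|u l'|u l1 l2|] /=; rewrite /upd; try case: eqP => [->|_]; lia.
Qed.

Lemma tile_at_far i j k : B <= i -> B <= j -> tile_at i k = tile_at j k.
Proof.
move=> iB jB; rewrite /tile_at; case: (leqP k T) => _; congr pair; apply/ffunP => r.
  by rewrite !ffunE; have := run_bound (T - k) r; rewrite /B in iB jB; lia.
rewrite !ffunE; have := run_bound 0 r; rewrite /run /= /B in iB jB *; lia.
Qed.

Lemma tile_at_late i j k : T < j -> T < k -> tile_at i j = tile_at i k.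
Proof. by rewrite /tile_at !ltnNge => /negbTE -> /negbTE ->. Qed.

(** Counters that saturate at [B] and [T + 1] still determine the tile, which is why finite memory
    suffices. *)
Lemma tile_at_minn d i k :
  tile_at (minn i B + d) (minn k T.+1) = tile_at (i + d) k.
Proof.
have -> : tile_at (minn i B + d) (minn k T.+1) = tile_at (i + d) (minn k T.+1).
  by case: (leqP i B) => // iB; apply: tile_at_far; lia.
by case: (leqP k T.+1) => // kT; apply: tile_at_late; lia.
Qed.

Definition counter : finType := ('I_B.+1 * 'I_T.+2)%type.

Definition count_letter (m : counter) (o : option bool) : counter :=
  match o with
  | None => m
  | Some false => (inord (minn m.1.+1 B), m.2)
  | Some true => (m.1, inord (minn m.2.+1 T.+1))
  end.

Definition occ (b : bool) (w : seq (option bool)) := count (pred1 (Some b)) w.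

Lemma foldl_count w :
  foldl count_letter (ord0, ord0) w =
  (inord (minn (occ false w) B), inord (minn (occ true w) T.+1)).
Proof.
elim/last_ind: w => [|w o IH].
  by rewrite /= !min0n; congr pair; apply: val_inj; rewrite /= inordK.
rewrite foldl_rcons IH /occ -cats1 !count_cat /=.
case: o => [[]|] /=; rewrite !addn0 ?addn1 //; congr pair; apply: val_inj;
  rewrite /= !inordK; lia.
Qed.

Variable n : nat.
Notation arena := (arena n x).

Definition obs_letter (j : 'I_n.+3) (o : obs arena j) : option bool :=
  if [pick s in val o] is Some s then @letter x (j == player1 n) s else None.

Lemma obs_letterE (j : 'I_n.+3) (s : State arena) :
  obs_letter (obs_of j s) = @letter x (j == player1 n) s.
Proof.
rewrite /obs_letter; case: pickP => [t|/(_ s)]; rewrite inE /= /same.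
  by move=> /eqP ->.
by rewrite eqxx.
Qed.

(** The shift by one is the column [i + 1] of player 2; the booleans are arbitrary, since only those
    of player 3 are read. *)
Definition answer (j : 'I_n.+3) (m : counter) : action :=
  (tile_at (m.1 + (j != player1 n)) m.2, (false, false)).

Definition count_obs (j : 'I_n.+3) (m : counter) (o : obs arena j) : counter :=
  count_letter m (obs_letter o).

Definition guide (j : 'I_n.+3) : strategy arena j :=
  fun h => answer j (foldl (@count_obs j) (ord0, ord0) h).

Arguments guide : clear implicits.

(** The output function counts the current observation itself, because the memory has not read it
    yet. *)
Definition guide_transducer (j : 'I_n.+3) : transducer (obs arena j) (Act arena) :=
  @Transducer _ _ counter (ord0, ord0) (@count_obs j)
    (fun m o => answer j (count_obs m o)).

Lemma guide_finite j : finite_memory_strategy (guide j).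
Proof.
split; first by move=> rho l _; rewrite inE.
exists (guide_transducer j) => rho l _.
by rewrite /obs_history mkseqS map_rcons /guide foldl_rcons.
Qed.

Definition letters (j : 'I_n.+3) (rho : nat -> State arena) (l : nat) :=
  [seq @letter x (j == player1 n) s | s : State arena <- mkseq rho l].

Lemma count_obsE j m (s : State arena) :
  count_obs m (obs_of j s) = count_letter m (@letter x (j == player1 n) s).
Proof. by rewrite /count_obs obs_letterE. Qed.

Lemma foldl_count_obs j (w : seq (State arena)) m :
  foldl (@count_obs j) m [seq obs_of j s | s <- w] =
  foldl count_letter m [seq @letter x (j == player1 n) s | s : State arena <- w].
Proof. exact: foldl_map2 (count_obsE j) m w. Qed.

Lemma answer_count j w : answer j (foldl count_letter (ord0, ord0) w) =
  (tile_at (occ false w + (j != player1 n)) (occ true w), (false, false)).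
Proof.
rewrite foldl_count /answer; congr pair.
by rewrite [(_, _).1]/= [(_, _).2]/= !inordK ?ltnS ?geq_minr // tile_at_minn.
Qed.

Lemma guideE j (rho : nat -> State arena) l :
  guide j (obs_history j rho l) =
  (tile_at (occ false (letters j rho l.+1) + (j != player1 n))
           (occ true (letters j rho l.+1)), (false, false)).
Proof. by rewrite /guide /obs_history foldl_count_obs answer_count. Qed.

(* [a1], [b1] and [a2], [b2] count the letters a and b read by players 1 and 2. *)
Definition follows (s : gstate x) (a1 b1 a2 b2 : nat) : Prop :=
  match s with
  | inl (inl _) => (a1, b1, a2, b2) = (0, 0, 0, 0)
  | inl (inr (inl (inl (z, (p1, p2)), _))) => a2 = a1 /\ exists k,
      [/\ b1 = k.+1, b2 = k.+1, p1 = tile_at a1 k & p2 = tile_at a1.+1 k] /\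
      (z = Some false -> a1 = 0) /\ (z = Some true -> a1 = x.+1)
  | inl (inr (inl (inr p, _))) | inl (inr (inr (inl (p, _)))) =>
      [/\ a1 = a2.+1, b2 = b1.+1 & p = tile_at a1 b1]
  | inl (inr (inr (inr _))) => [/\ a1 = a2, b1 = 0 & b2 = 0]
  | inr k => [/\ a1 = k.+1, a2 = k.+1, b1 = 0 & b2 = 0]
  end.

Lemma follows_check s a1 b1 a2 b2 : follows s a1 b1 a2 b2 ->
  check s (tile_at a1 b1) (tile_at a2.+1 b2).
Proof.
case: s => [[[]|[[[[z [p1 p2]]|p] b]|[[p b]|b]]]|k] //=.
- by case=> -> -> -> ->; apply: tile_at_row0.
- by case=> -> [k [[-> -> -> ->] [zf zt]]]; apply: tile_at_step.
- by case=> _ _ ->.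
- by case=> _ _ ->.
- by case=> -> -> ->; apply: tile_at_row0.
Qed.

Lemma follows_next s a1 b1 a2 b2 e : follows s a1 b1 a2 b2 ->
  let s' := next s (tile_at a1 b1) (tile_at a2.+1 b2) e in
  follows s' (a1 + (letter true s' == Some false)) (b1 + (letter true s' == Some true))
    (a2 + (letter false s' == Some false)) (b2 + (letter false s' == Some true)).
Proof.
case: s => [[[]|[[[[z [p1 p2]]|p] b]|[[p b]|b]]]|k] /=.
- case=> -> -> -> ->; case: e => [[] []] /=; rewrite ?addn0 ?addn1 //.
  by split=> //; exists 0.
- case=> -> [k [[-> -> _ _] zP]]; rewrite !addn0 !addn1; split=> //.
  by exists k.+1.
- by case=> -> -> _; rewrite !addn0 !addn1.
- by case=> -> -> _; rewrite !addn0 !addn1.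
- case=> -> -> ->; case: e => [[] []] /=; rewrite ?addn0 ?addn1 //.
  by split=> //; exists 0.
- case=> -> -> -> ->; case: ltnP => kx /=; rewrite ?addn0 ?addn1.
    by rewrite inordK.
  (* Here [k = x], so the step branch is entered after exactly [x + 1] letters a. *)
  split=> //; exists 0; split=> //; split=> // _; have := ltn_ord k; lia.
Qed.

Lemma run_safe : safe (SStart : State arena).
Proof.
exists (fun j => guide j); split=> [j _|]; first exact: guide_finite.
move=> j jA s' ss rho [rho0 tr].
(* [SStart] is the only state with letter [None], hence alone in its observation set. *)
have {s' ss}{}rho0 : rho 0 = SStart.
  rewrite rho0; move: ss; rewrite /= /same.
  by case: s' {rho0} => [[[]|[[[[z [p1 p2]]|p] b]|[[p b]|b]]]|k] //= /eqP.
have nextE t : exists e, rho t.+1 = next (rho t)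
    (tile_at (occ false (letters (player1 n) rho t.+1)) (occ true (letters (player1 n) rho t.+1)))
    (tile_at (occ false (letters (player2 n) rho t.+1)).+1
             (occ true (letters (player2 n) rho t.+1))) e.
  have [m [<- mA]] := tr t; exists (tnth (val m) (player3 n)).2.
  rewrite -[Tab m]/(@tab n x (rho t) m) /tab (mA (player1 n)) ?inE ?eqxx //.
  rewrite (mA (player2 n)) ?inE ?eqxx ?orbT // !guideE eqxx addn0.
  by rewrite (_ : (player2 n != player1 n) = true) // addn1.
have inv t : follows (rho t)
    (occ false (letters (player1 n) rho t.+1)) (occ true (letters (player1 n) rho t.+1))
    (occ false (letters (player2 n) rho t.+1)) (occ true (letters (player2 n) rho t.+1)).
  elim: t => [|t IH]; first by rewrite /letters /= rho0.
  have [e et] := nextE t; have := follows_next e IH; rewrite -et.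
  rewrite /letters !(mkseqS _ t.+1) !map_rcons /occ -!cats1 !count_cat /= !addn0.
  by [].
case=> [|t]; first by rewrite rho0.
by have [e ->] := nextE t; apply: check_next; apply: follows_check.
Qed.
End Run.

Theorem safe_iff_halts n x :
  safe (SStart : State (arena n x)) <-> halts prog (l0, input r0 x.+2).
Proof.
split; first exact: safe_halts.
case=> k kH.
(* A boolean form of halting, in which the bits are arbitrary, yields a least halting time. *)
have ex : exists k, halted (Some (iter k (step prog) (l0, input r0 x.+2)).1, [ffun=> true]).
  by exists k; rewrite /halted /= kH.
case: (ex_minnP ex) => T TH Tmin; apply: (@run_safe x T).
  by move: TH; rewrite /halted /=; case: (prog _).
move=> t tT tH; have := Tmin t; rewrite /halted /= tH => /(_ isT); lia.
Qed.

End Game.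

(** * Computable functions and sequence codes *)

Definition computable (d : nat) (F : seq nat -> nat) : Prop :=
  exists e, forall xs, size xs = d -> eval e xs (F xs).

Lemma computable_ext d F G : (forall xs, size xs = d -> F xs = G xs) ->
  computable d F -> computable d G.
Proof. by move=> FG [e he]; exists e => xs hx; rewrite -FG //; apply: he. Qed.

Lemma computable_nth d i : computable d (nth 0 ^~ i).
Proof. by exists (Proj i) => xs _; constructor. Qed.

Lemma computable_app d F (Gs : seq (seq nat -> nat)) :
  computable (size Gs) F -> foldr (fun G => and (computable d G)) True Gs ->
  computable d (fun xs => F [seq G xs | G : seq nat -> nat <- Gs]).
Proof.
case=> f hf hG.
have [gs hgs] : exists gs, forall xs, size xs = d ->
    eval_seq gs xs [seq G xs | G : seq nat -> nat <- Gs].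
  elim: Gs hG {hf} => [|G Gs IH] /=; first by exists [::] => xs _; constructor.
  case=> [[g hg] /IH[gs hgs]]; exists (g :: gs) => xs hx.
  by constructor; [apply: hg | apply: hgs].
exists (Comp f gs) => xs hx; apply: eval_Comp (hgs _ hx) _.
by apply: hf; rewrite size_map.
Qed.

Definition computable1 (f : nat -> nat) := computable 1 (fun xs => f (nth 0 xs 0)).
Definition computable2 (f : nat -> nat -> nat) :=
  computable 2 (fun xs => f (nth 0 xs 0) (nth 0 xs 1)).
Definition computable3 (f : nat -> nat -> nat -> nat) :=
  computable 3 (fun xs => f (nth 0 xs 0) (nth 0 xs 1) (nth 0 xs 2)).

Lemma computable_app1 f d G : computable1 f -> computable d G ->
  computable d (fun xs => f (G xs)).
Proof. by move=> hf hG; apply: (computable_app (Gs := [:: G]) hf). Qed.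

Lemma computable_app2 f d G H : computable2 f -> computable d G -> computable d H ->
  computable d (fun xs => f (G xs) (H xs)).
Proof. by move=> hf hG hH; apply: (computable_app (Gs := [:: G; H]) hf). Qed.

Lemma computable_app3 f d G H K : computable3 f -> computable d G ->
  computable d H -> computable d K -> computable d (fun xs => f (G xs) (H xs) (K xs)).
Proof. by move=> hf hG hH hK; apply: (computable_app (Gs := [:: G; H; K]) hf). Qed.

Lemma computable_rec d A H N : computable d A -> computable d.+2 H ->
  computable d N ->
  computable d (fun xs => nat_rec (fun=> nat) (A xs) (fun k r => H [:: k, r & xs]) (N xs)).
Proof.
move=> [a ha] [h hh] hN.
pose F xs := nat_rec (fun=> nat) (A (behead xs))
   (fun k r => H [:: k, r & behead xs]) (head 0 xs).
have cF : computable d.+1 F.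
  exists (PrimRec a h) => -[//|k xs] [hx]; rewrite /F /=.
  elim: k => [|k IH] /=; first by constructor; apply: ha.
  by apply: eval_PrimRecS IH _; apply: hh; rewrite /= hx.
(* [PrimRec] recurses on its first argument: [N] is put in front and the arguments are copied by
   projections. *)
have := @computable_app d F (N :: [seq (nth 0 ^~ i) | i <- iota 0 d]).
rewrite /= size_map size_iota => /(_ cF) h'.
apply: computable_ext (h' _) => [xs hx|].
  rewrite /F /= -map_comp (_ : map _ _ = xs) //.
  by rewrite -[RHS](mkseq_nth 0) hx.
split=> //; elim: (iota 0 d) => //= i s IH; split=> //.
exact: computable_nth.
Qed.

Lemma computable_succ : computable1 succn.
Proof. by exists Succ => xs _; constructor. Qed.

Lemma computable_const d c : computable d (fun=> c).
Proof.
elim: c => [|c IH]; first by exists Zero => xs _; constructor.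
exact: (computable_app1 computable_succ IH).
Qed.

Lemma computable_add : computable2 addn.
Proof.
apply: computable_ext (computable_rec (computable_nth 2 0)
  (computable_app1 computable_succ (computable_nth 4 1)) (computable_nth 2 1)) => xs _ /=.
by elim: (nth _ _ 1) => /= [|k ->]; rewrite ?addn0 ?addnS.
Qed.

Lemma computable_mul : computable2 muln.
Proof.
apply: computable_ext (computable_rec (computable_const 2 0)
  (computable_app2 computable_add (computable_nth 4 2) (computable_nth 4 1))
  (computable_nth 2 1)) => xs _ /=.
by elim: (nth _ _ 1) => /= [|k ->]; rewrite ?muln0 ?mulnS.
Qed.

Lemma computable_pow2 : computable1 (expn 2).
Proof.
apply: computable_ext (computable_rec (computable_const 1 1)
  (computable_app2 computable_mul (computable_const 3 2) (computable_nth 3 1))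
  (computable_nth 1 0)) => xs _ /=.
by elim: (nth _ _ 0) => /= [|k ->]; rewrite ?expn0 ?expnS.
Qed.

Lemma computable_pred : computable1 predn.
Proof.
apply: computable_ext (computable_rec (computable_const 1 0)
  (computable_nth 3 0) (computable_nth 1 0)) => xs _ /=.
by case: (nth _ _ 0).
Qed.

Lemma computable_sub : computable2 subn.
Proof.
apply: computable_ext (computable_rec (computable_nth 2 0)
  (computable_app1 computable_pred (computable_nth 4 1)) (computable_nth 2 1)) => xs _ /=.
by elim: (nth _ _ 1) => /= [|k ->]; rewrite ?subn0 ?subnS.
Qed.

Lemma computable_odd : computable1 (fun k => odd k).
Proof.
apply: computable_ext (computable_rec (computable_const 1 0)
  (computable_app2 computable_sub (computable_const 3 1) (computable_nth 3 1))
  (computable_nth 1 0)) => xs _ /=.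
by elim: (nth _ _ 0) => //= k ->; case: odd.
Qed.

Lemma computable_half : computable1 half.
Proof.
apply: computable_ext (computable_rec (computable_const 1 0)
  (computable_app2 computable_add
    (computable_app1 computable_odd (computable_nth 3 0)) (computable_nth 3 1))
  (computable_nth 1 0)) => xs _ /=.
by elim: (nth _ _ 0) => //= k ->; rewrite uphalf_half.
Qed.

(* [ccons] and [crep] are list operations on codes, see [code_cons], [code_nseq_cat]. *)
Definition ccons (v c : nat) : nat := 2 ^ v * c.*2.+1.
Definition crep (v n c : nat) : nat := iter n (ccons v) c.

Lemma code_cons v s : CodeSeq.code (v :: s) = ccons v (CodeSeq.code s).
Proof. by []. Qed.

Lemma code_nseq_cat n v s :
  CodeSeq.code (nseq n v ++ s) = crep v n (CodeSeq.code s).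
Proof. by elim: n => //= n ->. Qed.

Lemma computable_cons : computable2 ccons.
Proof.
apply: computable_ext (computable_app2 computable_mul
  (computable_app1 computable_pow2 (computable_nth 2 0))
  (computable_app1 computable_succ
    (computable_app2 computable_add (computable_nth 2 1) (computable_nth 2 1)))) => xs _.
by rewrite /ccons addnn.
Qed.

Lemma computable_rep : computable3 crep.
Proof.
apply: computable_ext (computable_rec (computable_nth 3 2)
  (computable_app2 computable_cons (computable_nth 5 2) (computable_nth 5 1))
  (computable_nth 3 1)) => xs _ /=.
by rewrite /crep; elim: (nth _ _ 1) => //= k ->.
Qed.

(* A nonempty list is coded by 2 ^ head * (2 * tail + 1), which repeated halving decodes. *)
Definition strip (z : nat) : nat := if odd z then z else z./2.
Definition chead (z : nat) : nat := \sum_(i < z) ~~ odd (iter i strip z).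
Definition ctail (z : nat) : nat := (iter z strip z)./2.

Lemma iter_strip v c i :
  iter i strip (ccons v c) = ccons (v - i) c.
Proof.
elim: i => [|i IH]; first by rewrite subn0.
rewrite iterS IH /strip /ccons; case: (ltnP i v) => [lt|le].
  rewrite -(subnSK lt) expnS -mulnA mul2n odd_double doubleK //.
have /eqP -> : v - i == 0 by rewrite subn_eq0.
have /eqP -> : v - i.+1 == 0 by rewrite subn_eq0 ltnW.
by rewrite mul1n /= odd_double.
Qed.

Lemma ccons_odd v c : odd (ccons v c) = (v == 0).
Proof. by rewrite /ccons oddM oddX /= odd_double orbF andbT. Qed.

Lemma ccons_gt v c : v < ccons v c.
Proof. exact: leq_trans (ltn_expl _ _) (leq_pmulr _ _). Qed.

(** The first [v] rounds see even numbers and the others odd ones; as [v < z], [z] rounds are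
    enough. *)
Lemma chead_cons v c : chead (ccons v c) = v.
Proof.
rewrite /chead; set z := ccons v c.
have -> : \sum_(i < z) ~~ odd (iter i strip z) = \sum_(i < z) (i < v).
  by apply: eq_bigr => i _; rewrite iter_strip ccons_odd subn_eq0 -ltnNge.
suff -> : forall m, \sum_(i < m) (i < v) = minn m v by have := ccons_gt v c; rewrite -/z; lia.
by elim=> [|m IH]; rewrite ?big_ord0 ?min0n // big_ord_recr /= IH; lia.
Qed.

Lemma ctail_cons v c : ctail (ccons v c) = c.
Proof.
rewrite /ctail iter_strip; have /eqP -> : v - ccons v c == 0.
  by rewrite subn_eq0 ltnW ?ccons_gt.
by rewrite /ccons mul1n /= uphalf_double.
Qed.

Lemma computable_strip : computable1 strip.
Proof.
apply: computable_ext (computable_app2 computable_add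
  (computable_app2 computable_mul (computable_app1 computable_odd (computable_nth 1 0))
     (computable_nth 1 0))
  (computable_app2 computable_mul
     (computable_app2 computable_sub (computable_const 1 1)
        (computable_app1 computable_odd (computable_nth 1 0)))
     (computable_app1 computable_half (computable_nth 1 0)))) => xs _.
by rewrite /strip; case: odd => /=; lia.
Qed.

Lemma computable_iter_strip : computable2 (fun i z => iter i strip z).
Proof.
apply: computable_ext (computable_rec (computable_nth 2 1)
  (computable_app1 computable_strip (computable_nth 4 1)) (computable_nth 2 0)) => xs _ /=.
by elim: (nth _ _ 0) => //= k ->.
Qed.

Lemma computable_head : computable1 chead.
Proof.
apply: computable_ext (computable_rec (computable_const 1 0)
  (computable_app2 computable_add (computable_nth 3 1)
    (computable_app2 computable_sub (computable_const 3 1)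
       (computable_app1 computable_odd
         (computable_app2 computable_iter_strip (computable_nth 3 0) (computable_nth 3 2)))))
  (computable_nth 1 0)) => xs _ /=.
rewrite /chead; move: (nth 0 xs 0) => z.
suff h m : nat_rec (fun=> nat) 0 (fun k r => r + (1 - odd (iter k strip z))) m =
  \sum_(i < m) ~~ odd (iter i strip z) by apply: h.
elim: m => [|k IH]; first by rewrite big_ord0.
by rewrite big_ord_recr /= IH; case: odd.
Qed.

Lemma computable_tail : computable1 ctail.
Proof.
exact: (computable_app1 computable_half (computable_app2 computable_iter_strip
  (computable_nth 1 0) (computable_nth 1 0))).
Qed.

Definition cnth (i z : nat) : nat := chead (iter i ctail z).

Lemma cnth_code i s : i < size s -> cnth i (CodeSeq.code s) = nth 0 s i.
Proof.
rewrite /cnth; elim: i s => [|i IH] [|v s] //= h; first exact: chead_cons.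
by rewrite -iterS iterSr -/(ccons v _) ctail_cons IH.
Qed.

Lemma computable_cnth i d G : computable d G -> computable d (fun xs => cnth i (G xs)).
Proof.
move=> cG; apply: computable_app1 computable_head _.
elim: i => // i IH; exact: computable_app1 computable_tail IH.
Qed.

(** Appending is affine in the code of the tail with slope [weight s], so a fixed prefix enters the
    game code through two constants. *)
Definition weight (s : seq nat) : nat := foldr (fun v w => 2 ^ v.+1 * w) 1 s.

Lemma code_cat s t :
  CodeSeq.code (s ++ t) = CodeSeq.code s + weight s * CodeSeq.code t.
Proof.
elim: s => [|v s IH]; first by rewrite /= mul1n.
by rewrite /= IH doubleD -addSn mulnDr -!mul2n expnS !mulnA (mulnC 2 (2 ^ v)).
Qed.

(** * The code of the game and the diagonal argument *)

(** Left summands come first, so the states outside the corridor keep their ranks when [x]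
    varies. *)
Lemma enum_sum (T1 T2 : finType) : enum {: T1 + T2} =
  [seq inl x | x <- enum T1] ++ [seq inr y | y <- enum T2].
Proof. by rewrite !enumT [in LHS]unlock. Qed.

Lemma map_enum_sum (T1 T2 : finType) (A : Type) (f : T1 + T2 -> A) :
  [seq f x | x <- enum {: T1 + T2}] =
  [seq f (inl x) | x <- enum T1] ++ [seq f (inr y) | y <- enum T2].
Proof. by rewrite enum_sum map_cat -!map_comp. Qed.

Lemma enum_rank_index (T : finType) (x : T) : enum_rank x = index x (enum T) :> nat.
Proof.
by rewrite -{2}(nth_enum_rank x x) index_uniq ?enum_uniq // -cardE.
Qed.

Lemma rank_inl (T1 T2 : finType) (x : T1) :
  enum_rank (inl x : T1 + T2) = enum_rank x :> nat.
Proof.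
rewrite !enum_rank_index enum_sum index_cat map_f ?mem_enum //.
by rewrite index_map // => ? ? [].
Qed.

Lemma rank_inr (T1 T2 : finType) (y : T2) :
  enum_rank (inr y : T1 + T2) = #|T1| + enum_rank y :> nat.
Proof.
rewrite !enum_rank_index enum_sum index_cat ifN; last by apply/mapP => -[].
by rewrite size_map -cardE index_map // => ? ? [].
Qed.

Lemma map_const (T : finType) (f : T -> nat) (v : nat) : (forall x, f x = v) ->
  [seq f x | x <- enum T] = nseq #|T| v.
Proof. by move=> fv; rewrite cardE; elim: (enum T) => //= x s ->; rewrite fv. Qed.

Lemma code_fun_const (T : finType) (f : T -> nat) (v : nat) : (forall x, f x = v) ->
  code_fun f = crep v #|T| 0.
Proof.
by move=> fv; rewrite /code_fun /image_mem (map_const fv) -[nseq _ _]cats0 code_nseq_cat.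
Qed.

Lemma map_ord (A : Type) (m : nat) (f : nat -> A) :
  [seq f (val i) | i <- enum 'I_m] = [seq f i | i <- iota 0 m].
Proof. by rewrite -val_enum_ord -map_comp. Qed.

(* A player's start, b and a states form consecutive blocks of sizes 1, [u], [w]. *)
Definition indis_row (u w : nat) : nat :=
  ccons (ccons 1 (crep 0 u (crep 0 w 0)))
    (crep (ccons 0 (crep 1 u (crep 0 w 0))) u
      (crep (ccons 0 (crep 0 u (crep 1 w 0))) w 0)).

Section Code.
Variables (R L : finType) (prog : L -> instr R L) (l0 : L) (r0 : R).
Variables (n : nat) (AP : finType) (p : AP).

Notation model x := (arena_model prog l0 r0 n x AP).
Notation S0 x := (@SStart R L x : State (model x)).

Definition goal : form n.+3 AP := Coop (team n) (Always (Neg (Atom n.+3 p))).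

Lemma goal_safety : is_safety goal.
Proof. by exists (team n), p. Qed.

Lemma sat_goal x : sat_state goal (S0 x) <-> halts prog (l0, input r0 x.+2).
Proof.
rewrite -(safe_iff_halts prog l0 r0 n x) /= /safe.
have labE (s : gstate R L x) : (p \in (if bad s then [set: AP] else set0)) = bad s.
  by case: (bad s); rewrite inE.
split=> -[sigma [fin win]]; exists sigma; split=> // j jA s' ss rho out.
  move=> k; apply/negP => bk; apply: (win j jA s' ss rho out); exists k; split.
    by rewrite addn0 labE => /(_ bk).
  move=> l lk /=; rewrite addn0 labE; case: (bad (rho l)); last by right=> h; apply: h.
  by left=> /(_ isT).
move=> /= -[k [h _]]; apply: h; rewrite addn0 labE.
by apply/negP; apply: win ss _ out k.
Qed.

Notation FS := (fstate R L).
Notation A := (action R L).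

Lemma code_gstate x (f : gstate R L x -> nat) : code_fun f =
  CodeSeq.code ([seq f (inl s) | s <- enum FS] ++ [seq f (inr k) | k <- enum 'I_x.+1]).
Proof. by rewrite /code_fun /image_mem map_enum_sum. Qed.

Definition mov_row : nat := code_fun (fun j : 'I_n.+3 => code_fun (fun c : A => 1)).

Lemma code_Mov x :
  code_fun (fun s : State (model x) => code_fun (fun j : 'I_n.+3 =>
      code_fun (fun c : Act (model x) => nat_of_bool (c \in Mov s j)))) =
  crep mov_row (#|FS| + x.+1) 0.
Proof.
rewrite -(card_ord x.+1) -card_sum; apply: code_fun_const => s.
rewrite /mov_row /code_fun; congr CodeSeq.code; apply: eq_map => j.
by congr CodeSeq.code; apply: eq_map => c; rewrite inE.
Qed.

Definition row x (s : gstate R L x) : nat :=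
  code_fun (fun a : n.+3.-tuple A => (enum_rank (next prog l0 r0 s
     (tnth a (player1 n)).1 (tnth a (player2 n)).1 (tnth a (player3 n)).2)).+1).

Lemma code_Tab_row x : (fun s : State (model x) =>
   code_fun (fun a : n.+3.-tuple (Act (model x)) =>
      if (insub a : option (move s)) is Some m then (enum_rank (Tab m)).+1 else 0))
  =1 @row x.
Proof.
move=> s; rewrite /row /code_fun; congr CodeSeq.code; apply: eq_map => a.
case: insubP => [m _ ma|]; first by rewrite /= /tab ma.
by move/negP; case; apply/forallP => j; rewrite inE.
Qed.

(** Outside the corridor, a move leads to a fixed state or to the first corridor state, and their
    ranks do not involve [x]. *)
Lemma rank_next x (s : FS) c1 c2 e :
  enum_rank (next prog l0 r0 (inl s : gstate R L x) c1 c2 e) =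
  enum_rank (next prog l0 r0 (inl s : gstate R L 0) c1 c2 e) :> nat.
Proof.
case: s => [[]|[[[[z [p1 p2]]|q] b]|[[q b]|b]]] /=; try by rewrite !rank_inl.
  by case: e => [[] []]; rewrite ?rank_inl // !rank_inr !enum_rank_ord.
by case: e => [[] []]; rewrite ?rank_inl.
Qed.

Lemma row_inl x (s : FS) : row (inl s : gstate R L x) = row (inl s : gstate R L 0).
Proof.
rewrite /row /code_fun; congr CodeSeq.code; apply: eq_map => a.
by rewrite rank_next.
Qed.

Definition tuples : nat := #|{: n.+3.-tuple A}|.

(** Before the end of the corridor all moves lead to the next corridor state, entered as its rank
    plus one; the last corridor state behaves as in the game with [x = 0]. *)
Lemma row_inr x (k : 'I_x.+1) : row (inr k : gstate R L x) =
  if k < x then crep (#|FS| + k).+2 tuples 0 else row (inr ord0 : gstate R L 0).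
Proof.
rewrite /row /=; case: ltnP => kx.
  by apply: code_fun_const => a; rewrite rank_inr enum_rank_ord /= inordK // addnS.
by rewrite /code_fun; congr CodeSeq.code; apply: eq_map => a; rewrite !rank_inl.
Qed.

(* The last [t] rows of the part of the table that describes the corridor. *)
Definition chain (K m c x t : nat) : nat :=
  nat_rec (fun=> nat) c
    (fun k r => ccons (crep (K + (x - k.+1)).+2 m 0) r) t.

Lemma chainE K m s x t : t <= x ->
  CodeSeq.code ([seq crep (K + k).+2 m 0 | k <- iota (x - t) t] ++ s) =
  chain K m (CodeSeq.code s) x t.
Proof.
elim: t => [|t IH] tx //; rewrite [iota _ _]/= map_cons cat_cons code_cons.
by congr ccons; rewrite subnSK // IH // ltnW.
Qed.

Definition fixed_rows : seq nat := [seq row (inl s : gstate R L 0) | s <- enum FS].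
Definition last_row : nat := row (inr ord0 : gstate R L 0).

Lemma code_Tab x :
  code_fun (@row x) = CodeSeq.code fixed_rows +
    weight fixed_rows * chain #|FS| tuples (ccons last_row 0) x x.
Proof.
rewrite code_gstate code_cat; congr (CodeSeq.code _ + weight _ * _);
  try by apply: eq_map => s; rewrite row_inl.
rewrite -[ccons _ _]/(CodeSeq.code [:: last_row]) -chainE // subnn.
congr CodeSeq.code.
rewrite (eq_map (@row_inr x)) (map_ord x.+1 (fun k => if k < x then
   crep (#|FS| + k).+2 tuples 0 else row (inr ord0 : gstate R L 0))).
rewrite (_ : iota 0 x.+1 = iota 0 x ++ [:: x]); last by rewrite -(addn1 x) iotaD.
rewrite map_cat /= ltnn; congr (_ ++ _).
by apply/eq_in_map => k; rewrite mem_iota add0n => /andP[_ ->].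
Qed.

(** The [SEq0] states show a to player 1 and b to the others, hence the two splittings. *)
Definition blocks (first : bool) (x : nat) : nat * nat :=
  if first then (#|bstate R L|, #|{: tile R L * bool}| + (2 + x.+1))
  else (#|bstate R L| + #|{: tile R L * bool}|, 2 + x.+1).

Lemma letter_map first x (h : option bool -> nat) :
  code_fun (fun s : gstate R L x => h (letter first s)) =
  ccons (h None) (crep (h (Some true)) (blocks first x).1
                 (crep (h (Some false)) (blocks first x).2 0)).
Proof.
rewrite code_gstate !map_enum_sum -!catA.
rewrite (map_const (v := h None)) // (map_const (v := h (Some true))) //.
rewrite (map_const (v := h (Some (~~ first)))) //.
rewrite !(map_const (v := h (Some false))) // card_unit card_bool card_ord.
rewrite -[nseq x.+1 _]cats0 !code_nseq_cat; congr ccons.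
by case: first; rewrite /= /crep !iterD.
Qed.

Definition indis_code (x : nat) (first : bool) : nat :=
  indis_row (blocks first x).1 (blocks first x).2.

Lemma code_indis x :
  code_fun (fun j : 'I_n.+3 => code_fun (fun s : State (model x) =>
      code_fun (fun t : State (model x) => nat_of_bool (indis j s t)))) =
  ccons (indis_code x true) (crep (indis_code x false) n.+2 0).
Proof.
have rowE (j : 'I_n.+3) : code_fun (fun s : State (model x) =>
      code_fun (fun t : State (model x) => nat_of_bool (indis j s t))) =
    indis_code x (j == player1 n).
  have -> : code_fun (fun s : State (model x) =>
      code_fun (fun t : State (model x) => nat_of_bool (indis j s t))) =
      code_fun (fun s : gstate R L x => code_fun (fun t : gstate R L x =>
         nat_of_bool (letter (j == player1 n) s == letter (j == player1 n) t))) by [].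
  rewrite (letter_map _ x (fun o => code_fun (fun t : gstate R L x =>
         nat_of_bool (o == letter (j == player1 n) t)))).
  rewrite !(letter_map _ x (fun o' => nat_of_bool (_ == o'))) /indis_code.
  by [].
rewrite /code_fun /image_mem enum_ordSl map_cons code_cons; congr ccons; first exact: rowE.
rewrite -map_comp (map_const (v := indis_code x false)).
  by rewrite card_ord -[nseq _ _]cats0 code_nseq_cat.
by move=> i; apply: etrans (rowE _) _.
Qed.

Definition fixed_labels : seq nat := [seq code_fun (fun q : AP => nat_of_bool
   (q \in (if bad (inl s : gstate R L 0) then [set: AP] else set0))) | s <- enum FS].
Definition no_label : nat := code_fun (fun q : AP => 0).

Lemma code_label x :
  code_fun (fun s : State (model x) => code_fun (fun q : AP => nat_of_bool (q \in label s))) =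
  CodeSeq.code fixed_labels + weight fixed_labels * crep no_label x.+1 0.
Proof.
rewrite code_gstate code_cat; congr (_ + _ * _).
rewrite (map_const (v := no_label)) ?card_ord.
  by rewrite -[nseq _ _]cats0 code_nseq_cat.
move=> k; rewrite /no_label /code_fun; congr CodeSeq.code; apply: eq_map => q.
by rewrite /= inE.
Qed.

(* The data of the game that do not depend on [x]. *)
Definition params : seq nat :=
  [:: mov_row; #|FS|; CodeSeq.code fixed_rows; weight fixed_rows; tuples; last_row;
      #|bstate R L|; #|{: tile R L * bool}|; CodeSeq.code fixed_labels;
      weight fixed_labels; no_label; nat_of_ord (enum_rank (@SStart R L 0));
      code_form goal].
End Code.

(** The parameters form a function [a], so that they can be read from a list or decoded from [x]
    itself. *)
Definition input_code (n x : nat) (a : nat -> nat) : nat :=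
  ccons
   (ccons (crep (a 0) (a 1 + x.+1) 0)
   (ccons (a 2 + a 3 * chain (a 1) (a 4) (ccons (a 5) 0) x x)
   (ccons (ccons (indis_row (a 6) (a 7 + (2 + x.+1)))
             (crep (indis_row (a 6 + a 7) (2 + x.+1)) n.+2 0))
   (ccons (a 8 + a 9 * crep (a 10) x.+1 0) 0))))
  (ccons (a 11) (ccons (a 12) 0)).

Lemma code_inputE (R L : finType) (prog : L -> instr R L) l0 r0 n (AP : finType) (p : AP) x :
  code_input (SStart R L : State (arena_model prog l0 r0 n x AP)) (goal n p) =
  input_code n x (nth 0 (params prog l0 r0 n p)).
Proof.
have tabE : code_fun (fun s : State (arena_model prog l0 r0 n x AP) =>
   code_fun (fun a : n.+3.-tuple (Act (arena_model prog l0 r0 n x AP)) =>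
      if (insub a : option (move s)) is Some m then (enum_rank (Tab m)).+1 else 0)) =
   code_fun (@row _ _ prog l0 r0 n x).
  by congr CodeSeq.code; apply: eq_map; apply: code_Tab_row.
rewrite /code_input /code_iCGM !code_cons code_Mov code_indis code_label tabE code_Tab.
rewrite /input_code /=; congr (ccons _ (ccons _ _)).
by rewrite !rank_inl.
Qed.

Lemma computable_chain d K m c x t : computable d K -> computable d m ->
  computable d c -> computable d x -> computable d t ->
  computable d (fun xs => chain (K xs) (m xs) (c xs) (x xs) (t xs)).
Proof.
move=> cK cm cc cx ct.
have h : computable 5 (fun xs =>
    chain (nth 0 xs 0) (nth 0 xs 1) (nth 0 xs 2) (nth 0 xs 3) (nth 0 xs 4)).
  apply: (computable_rec (d := 5) (A := nth 0 ^~ 2) (N := nth 0 ^~ 4)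
    (H := fun xs => ccons
       (crep (nth 0 xs 2 + (nth 0 xs 5 - (nth 0 xs 0).+1)).+2 (nth 0 xs 3) 0)
       (nth 0 xs 1)));
    try exact: computable_nth.
  apply: (computable_app2 computable_cons _ (computable_nth _ _)).
  apply: (computable_app3 computable_rep _ (computable_nth _ _) (computable_const _ _)).
  do 2!apply: (computable_app1 computable_succ).
  apply: (computable_app2 computable_add (computable_nth _ _)).
  apply: (computable_app2 computable_sub (computable_nth _ _)).
  exact: (computable_app1 computable_succ (computable_nth _ _)).
by apply: (computable_app (Gs := [:: K; m; c; x; t]) h).
Qed.

Ltac compute_code :=
  repeat first
  [ apply: computable_const
  | apply: (computable_app2 computable_cons)
  | apply: (computable_app3 computable_rep)
  | apply: computable_chain
  | apply: (computable_app2 computable_add)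
  | apply: (computable_app2 computable_mul)
  | apply: (computable_app1 computable_succ)
  | assumption ].

Lemma computable_input_code n : computable1 (fun x => input_code n x (cnth^~ x)).
Proof.
have cx := computable_nth 1 0.
have ca i := computable_cnth i cx.
rewrite /input_code /indis_row /computable1.
by compute_code; apply: ca.
Qed.

Theorem mainTheorem7 (n : nat) (hn : 3 <= n) (AP : finType)
    (hAP : 0 < #|AP|) :
  ~ decidable_model_checking (@is_ATL n AP) /\
  ~ decidable_model_checking (@is_state_form n AP) /\
  ~ decidable_model_checking (@is_safety n AP).
Proof.
(* Safety formulas lie in both larger classes, so deciding either would decide them. *)
suff undec : ~ decidable_model_checking (@is_safety n AP).
  split; [|split=> //]; case=> e he; apply: undec; exists e => M s f [A [p ->]];
    apply: he; do ?constructor.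
case: n hn => [|[|[|n]]] // _; case=> e he.
have /card_gt0P[p _] := hAP.
(* The machine input is x + 2. *)
have [g hg] : computable1 (fun y => input_code n (y - 2) (cnth^~ (y - 2))).
  apply: (computable_app1 (computable_input_code n)).
  exact: (computable_app2 computable_sub (computable_nth 1 0) (computable_const 1 2)).
have [R [L [prog [l0 [r0 halt]]]]] := counter_machine (Comp e [:: g]).
(* The machine runs the decider on the game whose parameters are decoded from its input; it was
   built before [x], so [x] may code the parameters of this very machine. *)
pose x := CodeSeq.code (params prog l0 r0 n p).
have in_x : input_code n x (cnth^~ x) =
    code_input (SStart R L : State (arena_model prog l0 r0 n x AP)) (goal n p).
  rewrite code_inputE /x /input_code !cnth_code //.
have run b : eval e [:: input_code n x (cnth^~ x)] b ->
    halts prog (l0, input r0 x.+2) <-> b = 0.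
  move=> eb; apply: halt; apply: eval_Comp eb; constructor; last by constructor.
  by have := hg [:: x.+2] erefl; rewrite /= subSS subSS subn0.
have [yes no] := he _ (SStart R L : State (arena_model prog l0 r0 n x AP)) _ (goal_safety n p).
rewrite -in_x in yes no.
(* If the goal held, the decider would return 1 and the machine would not halt, against
   [sat_goal]. *)
have nsat : ~ sat_state (goal n p) (SStart R L : State (arena_model prog l0 r0 n x AP)).
  by move=> /[dup] /yes/run h /sat_goal/h.
(* The decider then returns 0, so the machine halts and the goal holds. *)
by apply: (nsat); apply/sat_goal/(run _ (no nsat)).
Qed.
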